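(* Given generators $a_1,\dots,a_k\in T_n$, there is an $\mathsf{NL}$ algorithm to check whether $\langle a_1,\dots,a_k\rangle$ is a Clifford semigroup.
   Context: $T_n$ is the full transformation semigroup on $[n]=\{1,\dots,n\}$: all maps $[n]\to[n]$, acting on the right, under composition. $\langle a_1,\dots,a_k\rangle$ is the subsemigroup of $T_n$ generated by $a_1,\dots,a_k$ ($k,n\ge 1$). In the input each transformation is given by its table of values, and $k,n$ are part of the input. A semigroup $S$ is completely regular if every element of $S$ belongs to some subgroup of $S$ (a subsemigroup of $S$ that is a group). A Clifford semigroup is a completely regular semigroup whose idempotents commute with each other. An $\mathsf{NL}$ algorithm means that the decision problem lies in $\mathsf{NL}$, the class of sets decidable in nondeterministic logarithmic space. *)

(* Defs.v *)
From HB Require Import structures.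
From Stdlib Require Import Relation_Operators.
From mathcomp Require Import all_boot.

Set Implicit Arguments.
Unset Strict Implicit.
Unset Printing Implicit Defensive.

(** * Semigroups *)

Section Semigroups.
Variable T : semigroupType.
Local Open Scope group_scope.

Inductive generated (A : seq T) : T -> Prop :=
| Generated_gen a : a \in A -> generated A a
| Generated_mul a b : generated A a -> generated A b -> generated A (a * b).

(* The identity [e] of [G] is any idempotent; it need not be a unit of [T]. *)
Definition is_subgroup (G : T -> Prop) : Prop :=
  (forall x y, G x -> G y -> G (x * y)) /\
  exists e, [/\ G e,
    forall x, G x -> e * x = x /\ x * e = x &
    forall x, G x -> exists y, [/\ G y, x * y = e & y * x = e]].

Definition completely_regular (S : T -> Prop) : Prop :=
  forall x, S x ->
    exists G : T -> Prop, [/\ is_subgroup G, forall y, G y -> S y & G x].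

Definition clifford (S : T -> Prop) : Prop :=
  completely_regular S /\
  forall e f, S e -> S f -> e * e = e -> f * f = f -> commute e f.

End Semigroups.

(** * The full transformation semigroup *)

(* The point [i : 'I_n] stands for the element [i.+1] of {1, ..., n}. *)
Definition transf (n : nat) : Type := {ffun 'I_n -> 'I_n}.

HB.instance Definition _ n := Finite.copy (transf n) {ffun 'I_n -> 'I_n}.

(* Maps act on the right, so [f] is applied first in the product [f * g]. *)
Definition transf_mul n (f g : transf n) : transf n := [ffun x => g (f x)].

Lemma transf_mulA n : associative (@transf_mul n).
Proof. by move=> f g h; apply/ffunP=> x; rewrite !ffunE. Qed.

HB.instance Definition _ n := isSemigroup.Build (transf n) (@transf_mulA n).

Lemma transf_mulE n (f g : transf n) (x : 'I_n) : (f * g)%g x = g (f x).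
Proof. by rewrite [(f * g)%g]/(transf_mul f g) ffunE. Qed.

(** * Nondeterministic logarithmic space *)

Inductive move := MoveLeft | Stay | MoveRight.

(* What the input head sees: the input word is delimited by two end markers. *)
Inductive input_symbol (A : Type) :=
  LeftEnd | RightEnd | InputSymbol of A.
Arguments LeftEnd {A}.
Arguments RightEnd {A}.

Record action (Q G : finType) (t : nat) := Action {
  new_state  : Q;
  input_move : move;
  written    : {ffun 'I_t -> G};
  work_move  : {ffun 'I_t -> move}
}.

(* A nondeterministic Turing machine with a two-way read-only input tape and
   [ntapes] one-way infinite work tapes; [trans] tells which actions are
   allowed, given the state, the scanned input symbol and the symbols scanned
   on the work tapes. *)
Record ntm (A : finType) := Ntm {
  state  : finType;
  wsym   : finType;
  ntapes : nat;
  blank  : wsym;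
  start  : state;
  final  : pred state;
  trans  : state -> input_symbol A -> {ffun 'I_ntapes -> wsym} ->
           pred (action state wsym ntapes)
}.

Section Runs.
Variables (A : finType) (M : ntm A) (w : seq A).

(* Input head position 0 is the left end marker, positions 1, ..., [size w]
   carry the letters of [w], and [(size w).+1] is the right end marker.
   Work cells beyond the end of the list [cells c i] are blank. *)
Record config := Config {
  cstate : state M;
  ihead  : nat;
  cells  : {ffun 'I_(ntapes M) -> seq (wsym M)};
  heads  : {ffun 'I_(ntapes M) -> nat}
}.

Definition init : config :=
  Config (start M) 0 [ffun => [::]] [ffun => 0].

Definition read_input (h : nat) : input_symbol A :=
  if h is p.+1 then
    if onth w p is Some a then InputSymbol a else RightEnd
  else LeftEnd.

Definition read_work (c : config) : {ffun 'I_(ntapes M) -> wsym M} :=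
  [ffun i => nth (blank M) (cells c i) (heads c i)].

(* A head moving left from position 0 stays there. *)
Definition shift (m : move) (h : nat) : nat :=
  match m with MoveLeft => h.-1 | Stay => h | MoveRight => h.+1 end.

Definition perform (c : config) (a : action (state M) (wsym M) (ntapes M)) :
    config :=
  Config (new_state a)
         (minn (shift (input_move a) (ihead c)) (size w).+1)
         [ffun i => set_nth (blank M) (cells c i) (heads c i) (written a i)]
         [ffun i => shift (work_move a i) (heads c i)].

Definition step (c c' : config) : Prop :=
  exists2 a, trans (cstate c) (read_input (ihead c)) (read_work c) a
           & c' = perform c a.

Definition reachable (c : config) : Prop := clos_refl_trans config step init c.

Definition accepts : Prop := exists2 c, reachable c & final (cstate c).

(* Accessibility for the converse of [step]: no computation is infinite. *)
Definition halts : Prop := Acc (fun c' c => step c c') init.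

Definition runs_in_space (s : nat) : Prop :=
  forall c, reachable c -> forall i, heads c i < s.

End Runs.

(* [trunc_log 2 m] is the integer part of the binary logarithm of [m]. *)
Definition NL (A : finType) (L : seq A -> Prop) : Prop :=
  exists (M : ntm A) (c : nat), forall w : seq A,
    [/\ halts M w,
        runs_in_space M w (c * (trunc_log 2 (size w)).+1) &
        accepts M w <-> L w].

(** * The decision problem *)

Inductive letter := Bit of bool | EndEntry | EndTable.

Definition letter_code (l : letter) : option (option bool) :=
  match l with
  | Bit b => Some (Some b) | EndEntry => Some None | EndTable => None
  end.
Definition letter_decode (o : option (option bool)) : letter :=
  match o with
  | Some (Some b) => Bit b | Some None => EndEntry | None => EndTable
  end.
Lemma letter_codeK : cancel letter_code letter_decode.
Proof. by case. Qed.

HB.instance Definition _ := Finite.copy letter (can_type letter_codeK).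

(* Binary digits of [m > 0], most significant digit first. *)
Definition binary (m : nat) : seq bool :=
  rev (mkseq (fun j => odd (m %/ 2 ^ j)) (trunc_log 2 m).+1).

Definition encode_point n (i : 'I_n) : seq letter :=
  rcons (map Bit (binary i.+1)) EndEntry.

Definition encode_transf n (f : transf n) : seq letter :=
  rcons (flatten [seq encode_point (f i) | i <- enum 'I_n]) EndTable.

Definition encode n (a : seq (transf n)) : seq letter :=
  flatten (map (@encode_transf n) a).

Definition clifford_problem (w : seq letter) : Prop :=
  exists n k (a : k.-tuple (transf n)),
    [/\ 0 < n, 0 < k, w = encode a & clifford (generated a)].

(* Main.v *)
(* Write e_i for the idempotent power of a_i.  If each a_i lies in a subgroup and
   each e_i commutes with all generators, then every product of generators has
   an inverse with respect to the product of the corresponding e_i, so the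
   semigroup is Clifford; conversely, idempotents of a Clifford semigroup are
   central.  Now e_i is determined by the image and the kernel of a_i, so the
   criterion says that a_i is injective on its image and that each a_j preserves
   both the image and the kernel of a_i: no power of a_i has to be computed.

   This first-order condition on the tables is tested in deterministic
   logarithmic space.  It is written as a term of a small language of primitive
   recursion over numbers capped by |w| + 1.  Such a term is evaluated by a
   program on finitely many counters, and a counter program is run by a Turing
   machine that keeps each counter in binary on its own work tape. *)

From HB Require Import structures.
From Stdlib Require Import Relation_Operators Operators_Properties.
From mathcomp Require Import all_boot zify.
Require Import Defs.

Set Implicit Arguments.
Unset Strict Implicit.
Unset Printing Implicit Defensive.

(** [NL] asks that all computations halt and that all reachable configurations respect the space
    bound. Determinism gives both from one run: if it ends in a stuck configuration, every
    computation is a prefix of it. A term uses a fixed number of registers, however deeply its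
    quantifiers and recursions are nested, so only the size of the values matters. The cap |w| + 1
    is harmless: an encoding has at most |w| points and |w| tables, and a number that reaches the
    cap while its digits are read stays there and fails the comparison with the degree. Words that
    encode no list of tables must be rejected too, so part of the work is to recognize encodings,
    with neither leading zeros nor tables of different lengths. *)

Lemma clos_rt_map (T U : Type) (R : T -> T -> Prop) (R' : U -> U -> Prop)
    (f : T -> U) :
  (forall x y, R x y -> R' (f x) (f y)) ->
  forall x y, clos_refl_trans T R x y -> clos_refl_trans U R' (f x) (f y).
Proof.
move=> RR' x y; elim=> [a b /RR' | a | a b c _ ab _ bc]; first exact: rt_step.
  exact: rt_refl.
exact: rt_trans ab bc.
Qed.

(** * Runs of a deterministic relation *)

Section DeterministicRuns.
Variables (T : Type) (R : T -> T -> Prop) (P : T -> Prop) (x z : T).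
Let RP u v := R u v /\ P v.

Hypothesis detR : forall u v v', R u v -> R u v' -> v = v'.
Hypothesis stuck_z : forall y, ~ R z y.
Hypothesis Px : P x.
Hypothesis run : clos_refl_trans T RP x z.

Lemma det_run_Acc : Acc (fun v u => R u v) x.
Proof.
elim: (clos_rt_rt1n _ _ _ _ run) stuck_z => [a|a b c [Rab _] _ IH] stuck.
  by split=> b /stuck.
by split=> b' /(detR Rab) <-; apply: IH.
Qed.

(** By determinism a path from [x] follows the run to [z], and it cannot go beyond the end because
    [z] is stuck. *)
Lemma det_run_reach y :
  clos_refl_trans T R x y -> P y /\ clos_refl_trans T RP y z.
Proof.
move=> xy; elim: (clos_rt_rtn1 _ _ _ _ xy) => [|a b Rab _ [_ az]]; first by split.
move: stuck_z Rab; elim: (clos_rt_rt1n _ _ _ _ az) => [c|c d e [Rac Pc] cd _] stuck Rab.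
  by case: (stuck _ Rab).
by rewrite (detR Rab Rac); split=> //; apply: clos_rt1n_rt.
Qed.

End DeterministicRuns.

(** * Counter programs *)

Section Programs.
Variable A : finType.

Variant op :=
  Inc of nat | Dec of nat | NonZero of nat
| Go of move | Sees of pred (input_symbol A).

Inductive prog :=
| Do of op
| Seq of prog & prog
| Ite of op & prog & prog
| While of op & prog.

Variables (w : seq A) (m B : nat).

Definition store : Type := nat * (nat -> nat).

Definition upd (f : nat -> nat) r v : nat -> nat :=
  fun k => if k == r then v else f k.

(** The simulation needs both bounds: below [B], a value has a successor that still fits in the bits
    of a counter, and decrementing 0 in binary would turn its zeros into ones. *)
Definition op_ok (o : op) (s : store) : bool :=
  match o with
  | Inc r => (r < m) && (s.2 r < B)
  | Dec r => (r < m) && (0 < s.2 r)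
  | NonZero r => r < m
  | _ => true
  end.

Definition op_res (o : op) (s : store) : bool :=
  match o with
  | NonZero r => s.2 r != 0
  | Sees P => P (read_input w s.1)
  | _ => true
  end.

Definition op_do (o : op) (s : store) : store :=
  match o with
  | Inc r => (s.1, upd s.2 r (s.2 r).+1)
  | Dec r => (s.1, upd s.2 r (s.2 r).-1)
  | Go d => (minn (shift d s.1) (size w).+1, s.2)
  | _ => s
  end.

Inductive exec : prog -> store -> store -> Prop :=
| Exec_Do o s : op_ok o s -> exec (Do o) s (op_do o s)
| Exec_Seq p q s s' s'' : exec p s s' -> exec q s' s'' -> exec (Seq p q) s s''
| Exec_Ite o p q s s' :
    op_ok o s -> exec (if op_res o s then p else q) (op_do o s) s' ->
    exec (Ite o p q) s s'
| Exec_end o p s : op_ok o s -> ~~ op_res o s -> exec (While o p) s (op_do o s)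
| Exec_loop o p s s' s'' :
    op_ok o s -> op_res o s -> exec p (op_do o s) s' ->
    exec (While o p) s' s'' -> exec (While o p) s s''.

(** A program counter is the place of an operation in the syntax tree; [None] marks the test of an
    [Ite] or a [While]. *)
Fixpoint pcs (p : prog) : finType :=
  match p with
  | Do _ => unit
  | Seq p q => (pcs p + pcs q)%type
  | Ite _ p q => option (pcs p + pcs q)%type
  | While _ p => option (pcs p)
  end.

Fixpoint entry (p : prog) : pcs p :=
  match p return pcs p with
  | Do _ => tt
  | Seq p q => inl (entry p)
  | Ite _ p q => None
  | While _ p => None
  end.

Fixpoint op_at (p : prog) : pcs p -> op :=
  match p return pcs p -> op with
  | Do o => fun=> o
  | Seq p q => fun c => match c with inl c => op_at c | inr c => op_at c end
  | Ite o p q => fun c =>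
      match c with
      | None => o | Some (inl c) => op_at c | Some (inr c) => op_at c
      end
  | While o p => fun c => if c is Some c then op_at c else o
  end.

(* [None] as a successor means that the program is left. *)
Fixpoint next (p : prog) : pcs p -> bool -> option (pcs p) :=
  match p return pcs p -> bool -> option (pcs p) with
  | Do o => fun _ _ => None
  | Seq p q => fun c b =>
      match c with
      | inl c => Some (if next c b is Some c' then inl c' else inr (entry q))
      | inr c => omap inr (next c b)
      end
  | Ite o p q => fun c b =>
      match c with
      | None => Some (Some (if b then inl (entry p) else inr (entry q)))
      | Some (inl c) => omap (Some \o inl) (next c b)
      | Some (inr c) => omap (Some \o inr) (next c b)
      end
  | While o p => fun c b =>
      match c with
      | None => if b then Some (Some (entry p)) else None
      | Some c => Some (next c b)
      end
  end.

Inductive flow (p : prog) :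
    option (pcs p) * store -> option (pcs p) * store -> Prop :=
| Flow c s : op_ok (op_at c) s ->
    flow (Some c, s) (next c (op_res (op_at c) s), op_do (op_at c) s).

Notation flows := (clos_refl_trans _ (@flow _)).

(** Serves to run a part inside a whole: [f] embeds the places of [p] into those of [q], and [x] is
    where control goes when [p] is left. *)
Lemma flow_embed (p q : prog) (f : pcs p -> pcs q) (x : option (pcs q)) :
  (forall c, op_at (f c) = op_at c) ->
  (forall c b, next (f c) b = if next c b is Some c' then Some (f c') else x) ->
  forall c s s', flows (Some c, s) (None : option (pcs p), s') ->
  flows (Some (f c), s) (x, s').
Proof.
move=> fo fn c s s'.
pose g (u : option (pcs p) * store) :=
  (if u.1 is Some c then Some (f c) else x, u.2).
apply: (@clos_rt_map _ _ _ _ g) => _ _ [d t ok].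
by rewrite /g /= -fn -fo; apply: Flow; rewrite fo.
Qed.

Lemma flow1 p (c : pcs p) s u : op_ok (op_at c) s ->
  flows (next c (op_res (op_at c) s), op_do (op_at c) s) u ->
  flows (Some c, s) u.
Proof. by move=> ok; apply: rt_trans; apply: rt_step; apply: Flow. Qed.

Lemma exec_flow p s s' :
  exec p s s' -> flows (Some (entry p), s) (None : option (pcs p), s').
Proof.
elim=> {p s s'} [o s ok|p q s s' s'' _ IHp _ IHq|o p q s s' ok _ IH|o p s ok res
  |o p s s' s'' ok res _ IHp _ IHw].
- by apply: flow1 => //; apply: rt_refl.
- apply: rt_trans (_ : flows (Some (inr (entry q)) : option (pcs (Seq p q)), s') _).
    by apply: (@flow_embed p (Seq p q) inl) IHp => // c b /=; case: next.
  by apply: (@flow_embed q (Seq p q) inr) IHq => // c b /=; case: next.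
- apply: flow1 => //=; move: IH; case: op_res => IH.
    by apply: (@flow_embed p (Ite o p q) (Some \o inl)) IH => // c b /=; case: next.
  by apply: (@flow_embed q (Ite o p q) (Some \o inr)) IH => // c b /=; case: next.
- by apply: flow1 => //=; rewrite (negPf res); apply: rt_refl.
- apply: flow1 => //=; rewrite res; apply: rt_trans IHw.
  by apply: (@flow_embed p (While o p) Some (Some None)) IHp => // c b /=; case: next.
Qed.

End Programs.

(** * Binary counters *)

Section Counters.
Variable A : finType.
Implicit Types (o : op A) (l : seq bool).

(* A counter is kept with its least significant bit first; leading zeros are
   allowed.  Operating on it is one sweep: at each bit, [sweep_bit] gives the
   new bit and, if the sweep ends there, the result of the operation;
   [sweep_end] does so for the blank cell after the last bit. *)
Definition sweep_bit o (x : bool) : bool * option bool :=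
  match o with
  | Inc _ => (~~ x, if x then None else Some true)
  | Dec _ => (~~ x, if x then Some true else None)
  | _ => (x, if x then Some true else None)
  end.

Definition sweep_end o : option bool * bool :=
  match o with
  | Inc _ => (Some true, true)
  | Dec _ => (None, true)
  | _ => (None, false)
  end.

Fixpoint sweep o l : seq bool * bool :=
  if l is x :: l' then
    if (sweep_bit o x).2 is Some b then ((sweep_bit o x).1 :: l', b)
    else ((sweep_bit o x).1 :: (sweep o l').1, (sweep o l').2)
  else (seq_of_opt (sweep_end o).1, (sweep_end o).2).

Fixpoint value l : nat := if l is x :: l' then x + (value l').*2 else 0.

Lemma value_Inc r l : value (sweep (Inc A r) l).1 = (value l).+1.
Proof. by elim: l => //= -[] l IH /=; rewrite ?IH; lia. Qed.

(** A bit is appended only if all bits are 1, and then the successor is 2 to the power [size l]; as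
    it is below [2 ^ K], there is room for one more bit. *)
Lemma size_Inc r K l : size l <= K -> (value l).+1 < 2 ^ K ->
  size (sweep (Inc A r) l).1 <= K.
Proof.
elim: l K => [|[] l IH] [|K] //=; rewrite expnS => lK vK.
by apply: IH; lia.
Qed.

Lemma value_Dec r l : 0 < value l -> value (sweep (Dec A r) l).1 = (value l).-1.
Proof. by elim: l => //= -[] l IH //=; lia. Qed.

Lemma size_Dec r l : size (sweep (Dec A r) l).1 = size l.
Proof. by elim: l => //= -[] l IH //=; rewrite IH. Qed.

Lemma sweep_NonZero r l : sweep (NonZero A r) l = (l, value l != 0).
Proof. by elim: l => //= -[] l IH //=; rewrite IH add0n double_eq0. Qed.

Lemma sweep_Dec_res r l : (sweep (Dec A r) l).2.
Proof. by elim: l => //= -[]. Qed.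

Lemma sweep_Inc_res r l : (sweep (Inc A r) l).2.
Proof. by elim: l => //= -[]. Qed.

End Counters.

(** * The Turing machine of a program *)

Definition move_code (d : move) : option bool :=
  match d with MoveLeft => Some false | Stay => None | MoveRight => Some true end.
Definition move_decode (o : option bool) : move :=
  match o with Some false => MoveLeft | None => Stay | Some true => MoveRight end.
Lemma move_codeK : cancel move_code move_decode. Proof. by case. Qed.
HB.instance Definition _ := Equality.copy move (can_type move_codeK).

Section ActionEq.
Variables (Q G : finType) (t : nat).

(** The transitions of a machine form a boolean predicate on actions; a deterministic machine allows
    only the action equal to a computed one. *)
Definition action_eqb (a b : action Q G t) : bool :=
  [&& new_state a == new_state b, input_move a == input_move b,
      written a == written b & work_move a == work_move b].

Lemma action_eqP a b : reflect (a = b) (action_eqb a b).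
Proof.
case: a b => [q d g k] [q' d' g' k']; apply: (iffP and4P) => /=.
  by case=> /eqP-> /eqP-> /eqP-> /eqP->.
by case=> -> -> -> ->; rewrite !eqxx.
Qed.

End ActionEq.

Section Machine.
Variables (A : finType) (p : prog A) (m : nat).

Let tapes := m.+1.
Let wsy : finType := option bool.

(* A machine state is a program counter, the result of the last operation, and
   a phase: [None] when an operation is about to start, [Some None] when the
   head of a work tape sweeps over a counter, and [Some (Some b)] when it
   returns with result [b].  Cell 0 of each work tape stays blank, so that it
   can be recognized; the counter starts in cell 1. *)
Definition phase : finType := option (option bool).
Definition mstate : finType := (option (pcs p) * bool * phase)%type.

Notation act := (action mstate wsy tapes).

Definition on_input (q : mstate) (d : move) (g : {ffun 'I_tapes -> wsy}) : act :=
  @Action mstate wsy tapes q d g [ffun=> Stay].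

Definition on_tape (r : 'I_tapes) (q : mstate) (x : wsy) (d : move)
    (g : {ffun 'I_tapes -> wsy}) : act :=
  @Action mstate wsy tapes q Stay [ffun i => if i == r then x else g i]
    [ffun i => if i == r then d else Stay].

Definition counter_act (c : pcs p) (b : bool) (ph : phase) (o : op A)
    (r : 'I_tapes) (g : {ffun 'I_tapes -> wsy}) : act :=
  match ph with
  | None => on_tape r (Some c, b, Some None) None MoveRight g
  | Some None =>
      if g r is Some x then
        if (sweep_bit o x).2 is Some b' then
          on_tape r (Some c, b, Some (Some b')) (Some (sweep_bit o x).1) MoveLeft g
        else on_tape r (Some c, b, Some None) (Some (sweep_bit o x).1) MoveRight g
      else on_tape r (Some c, b, Some (Some (sweep_end o).2)) (sweep_end o).1
             MoveLeft g
  | Some (Some b') =>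
      if g r is Some x then on_tape r (Some c, b, ph) (Some x) MoveLeft g
      else on_input (next c b', b', None) Stay g
  end.

Definition machine_act (q : mstate) (x : input_symbol A)
    (g : {ffun 'I_tapes -> wsy}) : option act :=
  if q is (Some c, b, ph) then Some
    match op_at c with
    | Go d => on_input (next c true, true, None) d g
    | Sees P => on_input (next c (P x), P x, None) Stay g
    | Inc r | Dec r | NonZero r => counter_act c b ph (op_at c) (inord r) g
    end
  else None.

Definition machine : ntm A :=
  @Ntm A mstate wsy tapes None (Some (entry p), true, None)
    (fun q => (q.1.1 == None) && q.1.2)
    (fun q x g a => if machine_act q x g is Some a' then action_eqb a a' else false).

Variable w : seq A.
Notation cfg := (config machine).
Notation mstep := (@step A machine w).

Definition acting (c : cfg) :=
  machine_act (cstate c) (read_input w (ihead c)) (read_work c).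

Lemma stepP (c c' : cfg) :
  mstep c c' <-> exists2 a, acting c = Some a & c' = perform w c a.
Proof.
rewrite /step /= -/(acting c); split=> [[a]|[a ea ->]]; last first.
  by exists a => //; rewrite ea; apply/action_eqP.
by case: (acting c) => // a' /action_eqP<- ->; exists a.
Qed.

Lemma step_det (c c1 c2 : cfg) : mstep c c1 -> mstep c c2 -> c1 = c2.
Proof. by move=> /stepP[a ea ->] /stepP[b]; rewrite ea => -[->] ->. Qed.

(** ** Simulation *)

Variables (K B : nat).
Hypothesis BK : B < 2 ^ K.

(** Besides the [K] bits there are two blank cells: cell 0, and the cell after the last bit, where a
    sweep may end. *)
Definition in_space (c : cfg) := forall i, heads c i < K.+2.
Notation sstep := (fun c c' : cfg => mstep c c' /\ in_space c').
Notation runs := (clos_refl_trans _ sstep).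

(** Compared cell by cell, because [cells] may store trailing blanks. *)
Definition holds (c : cfg) (i : 'I_tapes) (l : seq bool) :=
  nth None (cells c i) =1 nth None (None :: map Some l).

Definition idle (c : cfg) (i : 'I_tapes) (v : nat) :=
  heads c i = 0 /\ exists l, [/\ holds c i l, size l <= K & value l = v].

Definition represents (c : cfg) (u : option (pcs p) * store) (b : bool) :=
  [/\ cstate c = (u.1, b, None), ihead c = u.2.1 &
      forall i : 'I_tapes, idle c i (u.2.2 i)].

Definition sweeping (c : cfg) (q : mstate) h (r : 'I_tapes) (j : nat)
    (l : seq bool) (f : nat -> nat) :=
  [/\ cstate c = q, ihead c = h, holds c r l /\ heads c r = j &
      forall i, i != r -> idle c i (f i)].

Lemma sweeping_in_space c q h r j l f :
  sweeping c q h r j l f -> j < K.+2 -> in_space c.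
Proof.
case=> _ _ [_ hr] others jK i.
by have [->|/others[-> //]] := eqVneq i r; rewrite hr.
Qed.

Lemma on_tape_run c c0 b ph h r j l f q x d l' :
  sweeping c (Some c0, b, ph) h r j l f -> h <= (size w).+1 ->
  (forall g : {ffun 'I_tapes -> wsy}, g r = nth None (None :: map Some l) j ->
     machine_act (Some c0, b, ph) (read_input w h) g = Some (on_tape r q x d g)) ->
  (forall k, (if k == j then x else nth None (None :: map Some l) k)
     = nth None (None :: map Some l') k) ->
  shift d j < K.+2 ->
  exists2 c', runs c c' & sweeping c' q h r (shift d j) l' f.
Proof.
move=> [cq ch [cl cj] others] hw actE l'E jK.
have ca : acting c = Some (on_tape r q x d (read_work c)).
  by rewrite /acting cq ch; apply: actE; rewrite ffunE cj cl.
pose c' := perform w c (on_tape r q x d (read_work c)).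
have sw : sweeping c' q h r (shift d j) l' f.
  split=> //=.
  - by rewrite ch; apply/minn_idPl.
  - split; last by rewrite !ffunE eqxx cj.
    by move=> k; rewrite !ffunE eqxx nth_set_nth /= cj -l'E cl.
  move=> i ir; have [hi [li [lic liK liv]]] := others i ir.
  split; first by rewrite !ffunE (negPf ir).
  exists li; split=> // k; rewrite !ffunE (negPf ir) nth_set_nth /= -lic.
  by case: eqP => [->|].
exists c' => //; apply: rt_step; split.
  by apply/stepP; exists (on_tape r q x d (read_work c)).
exact: sweeping_in_space sw jK.
Qed.

Definition counter_op (o : op A) (r : 'I_tapes) : Prop :=
  o = Inc A r \/ o = Dec A r \/ o = NonZero A r.

Lemma counter_machine_act c0 b ph r x g :
  counter_op (op_at c0) r ->
  machine_act (Some c0, b, ph) x g = Some (counter_act c0 b ph (op_at c0) r g).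
Proof.
by case=> [|[]] e; rewrite /machine_act e; congr (Some (counter_act _ _ _ _ _ _));
  rewrite inord_val.
Qed.

(** Induction on the unread bits [l], with [l0] already rewritten. The bound on [j] keeps the head
    from stopping on a blank after the last bit, which the return phase would mistake for cell 0. *)
Lemma sweep_run c c0 b h r l0 l f :
  counter_op (op_at c0) r -> h <= (size w).+1 ->
  sweeping c (Some c0, b, Some None) h r (size l0).+1 (l0 ++ l) f ->
  size l0 + size l <= K ->
  exists2 c', runs c c' & exists2 j, j <= size l0 + size (sweep (op_at c0) l).1 &
    sweeping c' (Some c0, b, Some (Some (sweep (op_at c0) l).2)) h r j
      (l0 ++ (sweep (op_at c0) l).1) f.
Proof.
move=> co hw; elim: l l0 c => [|x l IH] l0 c sw lK.
  have [|k||c' cc' sw'] := on_tape_run sw hw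
    (q := (Some c0, b, Some (Some (sweep_end (op_at c0)).2)))
    (x := (sweep_end (op_at c0)).1) (d := MoveLeft)
    (l' := l0 ++ (sweep (op_at c0) [::]).1).
  - move=> g gr; rewrite (counter_machine_act _ _ _ _ co) /=.
    by move: gr; rewrite cats0 /= nth_default ?size_map // => ->.
  - rewrite cats0 /=; case: k => //= k; rewrite eqSS map_cat nth_cat size_map.
    case: ltngtP => // [kl|->]; last first.
      by rewrite subnn; case: (sweep_end _).1.
    rewrite nth_default ?size_map 1?ltnW // nth_default //.
    by case: (sweep_end _).1 => //= _; lia.
  - by move: lK => /=; lia.
  by exists c' => //; exists (size l0) => //; lia.
have nx : nth None (None :: map Some (l0 ++ x :: l)) (size l0).+1 = Some x.
  by rewrite /= map_cat nth_cat size_map ltnn subnn.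
have upd_nth y k : (if k == (size l0).+1 then Some y else
    nth None (None :: map Some (l0 ++ x :: l)) k) =
    nth None (None :: map Some (l0 ++ y :: l)) k.
  case: k => //= k; rewrite eqSS !map_cat !nth_cat size_map.
  case: ltngtP => // [kl|->]; last by rewrite subnn.
  by case: (k - size l0) (subn_gt0 (size l0) k) => //; rewrite kl.
rewrite /=; case E: (sweep_bit (op_at c0) x).2 => [b'|] /=.
  have [|k||c' cc' sw'] := on_tape_run sw hw (q := (Some c0, b, Some (Some b')))
    (x := Some (sweep_bit (op_at c0) x).1) (d := MoveLeft)
    (l' := l0 ++ (sweep_bit (op_at c0) x).1 :: l).
  - by move=> g gr; rewrite (counter_machine_act _ _ _ _ co) /= gr nx E.
  - exact: upd_nth.
  - by move: lK => /=; lia.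
  by exists c' => //; exists (size l0) => //; lia.
have [|k||c' cc' sw'] := on_tape_run sw hw (q := (Some c0, b, Some None))
    (x := Some (sweep_bit (op_at c0) x).1) (d := MoveRight)
    (l' := l0 ++ (sweep_bit (op_at c0) x).1 :: l).
- by move=> g gr; rewrite (counter_machine_act _ _ _ _ co) /= gr nx E.
- exact: upd_nth.
- by move: lK => /=; lia.
have [||c'' cc'' [j jl sw'']] := IH (rcons l0 (sweep_bit (op_at c0) x).1) c'.
- by rewrite cat_rcons size_rcons.
- by rewrite size_rcons; move: lK => /=; lia.
exists c''; first exact: rt_trans cc''.
exists j; last by rewrite -cat_rcons.
by move: jl; rewrite size_rcons /=; lia.
Qed.

Lemma return_run c c0 b b' h r j l f :
  counter_op (op_at c0) r -> h <= (size w).+1 -> j <= size l -> size l <= K ->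
  sweeping c (Some c0, b, Some (Some b')) h r j l f ->
  exists2 c', runs c c' & sweeping c' (Some c0, b, Some (Some b')) h r 0 l f.
Proof.
move=> co hw; elim: j c => [|j IH] c jl lK sw; first by exists c => //; apply: rt_refl.
have [|k||c' cc' sw'] := on_tape_run sw hw (q := (Some c0, b, Some (Some b')))
  (x := nth None (map Some l) j) (d := MoveLeft) (l' := l).
- move=> g gr; rewrite (counter_machine_act _ _ _ _ co) /= gr /=.
  by rewrite (nth_map false) //.
- by case: eqP => [->|].
- by rewrite /=; lia.
have [||c'' cc'' sw''] := IH c' _ _ sw'; [by lia|by []|].
by exists c'' => //; apply: rt_trans cc''.
Qed.

Lemma on_input_run (c : cfg) c0 b ph (f : nat -> nat) pc b' d :
  cstate c = (Some c0, b, ph) -> (forall i : 'I_tapes, idle c i (f i)) ->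
  machine_act (Some c0, b, ph) (read_input w (ihead c)) (read_work c)
    = Some (on_input (pc, b', None) d (read_work c)) ->
  exists2 c', runs c c' &
    represents c' (pc, (minn (shift d (ihead c)) (size w).+1, f)) b'.
Proof.
move=> cq ci actE; exists (perform w c (on_input (pc, b', None) d (read_work c))).
  apply: rt_step; split.
    apply/stepP; exists (on_input (pc, b', None) d (read_work c)) => //.
    by rewrite /acting cq.
  by move=> i; rewrite /= !ffunE /=; have [-> _] := ci i.
split=> // i; have [hi [l [lc lK lv]]] := ci i.
split; first by rewrite /= !ffunE.
exists l; split=> // k; rewrite /= !ffunE nth_set_nth /= -lc.
by case: eqP => [->|].
Qed.

(** Leading zeros make the list of bits of a value ambiguous, so the size bound is asked of every
    list and the conclusion speaks of some list. *)
Lemma counter_run (c : cfg) c0 b (s : store) r :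
  counter_op (op_at c0) r -> s.1 <= (size w).+1 ->
  represents c (Some c0, s) b ->
  (forall l, size l <= K -> value l = s.2 r -> size (sweep (op_at c0) l).1 <= K) ->
  exists2 c', runs c c' & exists2 l, value l = s.2 r &
    represents c' (next c0 (sweep (op_at c0) l).2,
                   (s.1, upd s.2 r (value (sweep (op_at c0) l).1)))
      (sweep (op_at c0) l).2.
Proof.
case: s => h f co hw [cq /= ch ci] sK; have [hr [l [lc lK lv]]] := ci r.
have sw : sweeping c (Some c0, b, None) h r 0 l f by split.
have [|k||c1 cc1 sw1] := on_tape_run sw hw (q := (Some c0, b, Some None))
  (x := None) (d := MoveRight) (l' := l).
- by move=> g gr; rewrite (counter_machine_act _ _ _ _ co).
- by case: k.
- by [].
have [|c2 c12 [j jl sw2]] := sweep_run (l0 := [::]) co hw sw1; first by [].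
have [//||c3 c23 [cq3 ch3 [lc3 cj3] ci3]] := return_run co hw _ _ sw2.
  exact: sK.
set b' := (sweep _ _).2 in cq3 *.
pose f' := upd f r (value (sweep (op_at c0) l).1).
have ci3' (i : 'I_tapes) : idle c3 i (f' i).
  rewrite /f' /upd; have [ir|ir] := eqVneq i r.
    by rewrite ir eqxx; split=> //; exists (sweep (op_at c0) l).1; split=> //; apply: sK.
  have -> : (i == r :> nat) = false by exact: negPf ir.
  exact: ci3.
have [|c4 c34 rep4] := on_input_run (pc := next c0 b') (b' := b') (d := Stay) cq3 ci3'.
  by rewrite (counter_machine_act _ _ _ _ co) /= ffunE cj3 lc3.
exists c4; first by
  apply: rt_trans c34; apply: rt_trans c23; apply: rt_trans c12.
exists l => //; move: rep4; rewrite ch3 /= (minn_idPl _) //.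
Qed.

Lemma op_run (c : cfg) c0 b (s : store) :
  op_ok tapes B (op_at c0) s -> s.1 <= (size w).+1 ->
  represents c (Some c0, s) b ->
  exists2 c', runs c c' &
    represents c' (next c0 (op_res w (op_at c0) s), op_do w (op_at c0) s)
      (op_res w (op_at c0) s).
Proof.
move=> ok hw rep; case E: (op_at c0) ok => [r|r|r|d|P] /= ok.
- case/andP: ok => rm rB.
  have [|l lK lv|c' cc' [l lv]] := counter_run (r := Ordinal rm) _ hw rep.
  + by left.
  + by rewrite E; apply: size_Inc => //; rewrite lv; apply: leq_ltn_trans BK.
  by rewrite E sweep_Inc_res value_Inc lv => rep'; exists c'.
- case/andP: ok => rm rB.
  have [|l lK lv|c' cc' [l lv]] := counter_run (r := Ordinal rm) _ hw rep.
  + by right; left.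
  + by rewrite E size_Dec.
  by rewrite E sweep_Dec_res value_Dec lv // => rep'; exists c'.
- have [|l lK lv|c' cc' [l lv]] := counter_run (r := Ordinal ok) _ hw rep.
  + by right; right.
  + by rewrite E sweep_NonZero.
  rewrite E sweep_NonZero lv /= => -[cq' ch' ci']; exists c' => //; split=> // i.
  by have:= ci' i; rewrite /= /upd; case: eqP => // ->.
- case: rep => cq ch ci.
  have [|c' cc' rep'] := on_input_run (pc := next c0 true) (b' := true) (d := d) cq ci.
    by rewrite /machine_act E.
  by exists c' => //; rewrite -ch.
case: rep => cq ch ci.
have [|c' cc' [cq' ch' ci']] := on_input_run (pc := next c0 (P (read_input w s.1)))
  (b' := P (read_input w s.1)) (d := Stay) cq ci.
  by rewrite /machine_act E -ch.
by exists c' => //; split=> //; rewrite ch' /= ch; apply/minn_idPl.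
Qed.

Lemma flows_run (c : cfg) b u u' :
  clos_refl_trans _ (@flow A w tapes B p) u u' -> u.2.1 <= (size w).+1 ->
  represents c u b -> u'.2.1 <= (size w).+1 /\
  exists2 c', runs c c' & exists b', represents c' u' b'.
Proof.
move=> uu'; elim: (clos_rt_rt1n _ _ _ _ uu') c b => [v|_ v v' [c0 s ok] _ IH] c b hw rep.
  by split=> //; exists c; [apply: rt_refl|exists b].
have [c1 cc1 rep1] := op_run ok hw rep.
have [|v'w [c' c1c' rep']] := IH c1 _ _ rep1; last first.
  by split=> //; exists c' => //; apply: rt_trans c1c'.
by case: (op_at c0) hw => //= d _; apply: geq_minr.
Qed.

End Machine.

(** * From terminating counter programs to space-bounded machines *)

Section Decision.
Variables (A : finType) (p : prog A) (m : nat).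

(* The last operation copies the answer from register 0 to the result bit. *)
Let M := machine (Seq p (Do (NonZero A 0))) m.

Theorem machine_correct w B K f' h' :
  B < 2 ^ K -> exec w m.+1 B p (0, fun=> 0) (h', f') ->
  [/\ halts M w, runs_in_space M w K.+2 & accepts M w <-> f' 0 != 0].
Proof.
move=> BK pf'; pose q := Seq p (Do (NonZero A 0)).
have init0 : represents K (init M) (Some (entry q), (0, fun=> 0)) true.
  split=> // i; split; first by rewrite ffunE.
  by exists [::]; split=> // k; rewrite ffunE; case: k => [|[]].
have fl := @flow_embed A w m.+1 B p q inl (Some (inr tt)) (fun=> erefl)
  _ _ _ _ (exec_flow pf').
have [|hw [c1 r1 [b1 rep1]]] := flows_run BK (fl _) isT init0.
  by move=> c b /=; case: next.
have [//|c2 r2 [c2q _ _]] := op_run BK _ hw rep1.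
have run : clos_refl_trans _ (fun c c' => step w c c' /\ in_space K c') (init M) c2.
  exact: rt_trans r2.
have stuck c : ~ step w c2 c by case/stepP=> a; rewrite /acting c2q.
have det := @step_det A q m w.
have in_space0 : in_space K (init M) by move=> i; rewrite ffunE.
split; first exact: det_run_Acc det stuck run.
  by move=> c /(det_run_reach det stuck in_space0 run)[].
split=> [[c cr cf]|f'0]; last first.
  exists c2; last by rewrite c2q /= f'0.
  by apply: (clos_rt_map (f := id)) run => ? ? [].
have [_ cc2] := det_run_reach det stuck in_space0 run cr.
(* A final configuration has left the program and is stuck, so it is the end of the only run. *)
have ec : c = c2.
  case: (clos_rt_rt1n _ _ _ _ cc2) cf => // c' ? [/stepP[a + _] _] _.
  by rewrite /acting /=; case: (cstate c) => [[[?|] ?] ?].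
by case/andP: cf => _; rewrite ec c2q.
Qed.

End Decision.

(** * Recursive terms *)

Definition at_left A (x : input_symbol A) := if x is LeftEnd then true else false.
Definition at_right A (x : input_symbol A) := if x is RightEnd then true else false.

Section Reading.
Variables (A : finType) (w : seq A).

Lemma at_rightE h : at_right (read_input w h) = (size w < h).
Proof.
case: h => //= h; rewrite ltnS; by elim: w h => [|x s IH] [|h] //=.
Qed.

End Reading.

Section Terms.
Variable A : finType.

(* Variables are de Bruijn indices.  In [Rec n a s], the step [s] sees the
   accumulator as variable 0 and the index of the step as variable 1. *)
Inductive term :=
| Var of nat
| Zero
| Top
| Succ of term
| Sym of pred (input_symbol A) & term
| Cond of term & term & term
| Rec of term & term & term.

Section Semantics.
Variable w : seq A.
Let B := (size w).+1.

Fixpoint eval (env : seq nat) (e : term) : nat :=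
  match e with
  | Var k => nth 0 env k
  | Zero => 0
  | Top => B
  | Succ e => minn (eval env e).+1 B
  | Sym P e => P (read_input w (eval env e))
  | Cond c a b => if eval env c != 0 then eval env a else eval env b
  | Rec n a s => iteri (eval env n) (fun i x => eval (x :: i :: env) s) (eval env a)
  end.

Lemma eval_le e env : all (leq^~ B) env -> eval env e <= B.
Proof.
elim: e env => [k||| e _|P e _|c _ a IHa b IHb|n IHn a IHa s IHs] env le_env //=.
- have [kn|kn] := ltnP k (size env); last by rewrite nth_default.
  by move/all_nthP: le_env; apply.
- exact: geq_minr.
- exact: leq_trans (leq_b1 _) _.
- by case: ifP => _; [apply: IHa|apply: IHb].
elim: (eval env n) (IHn _ le_env) => [|i IH] iB /=; first exact: IHa.
by apply: IHs; rewrite /= le_env IH ltnW.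
Qed.

End Semantics.

Definition clear r : prog A := While (NonZero A r) (Do (Dec A r)).

(** Reading a counter unit by unit destroys it, so [k] is emptied into [t] and then rebuilt from [t]
    together with [d]. *)
Definition copy d k t : prog A :=
  Seq (clear d) (Seq (clear t) (Seq
    (While (NonZero A k) (Seq (Do (Dec A k)) (Do (Inc A t))))
    (While (NonZero A t)
      (Seq (Do (Dec A t)) (Seq (Do (Inc A k)) (Do (Inc A d))))))).

Definition go_home : prog A :=
  While (Sees (predC (@at_left A))) (Do (Go A MoveLeft)).

Definition seek r t t' : prog A :=
  Seq (copy t r t') (Seq go_home
    (While (NonZero A t) (Seq (Do (Dec A t)) (Do (Go A MoveRight))))).

(* The value of the term goes to register [d]; variable [i] is in register
   [rs`_i], and only registers from [d] on are changed. *)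
Fixpoint compile (rs : seq nat) (d : nat) (e : term) : prog A :=
  match e with
  | Var k => if k < size rs then copy d (nth 0 rs k) d.+1 else clear d
  | Zero => clear d
  | Top => Seq (clear d) (Seq go_home
      (While (Sees (predC (@at_right A))) (Seq (Do (Go A MoveRight)) (Do (Inc A d)))))
  | Succ e => Seq (compile rs d e) (Seq (seek d d.+1 d.+2)
      (Ite (Sees (@at_right A)) (Do (Go A Stay)) (Do (Inc A d))))
  | Sym P e => Seq (compile rs d e) (Seq (seek d d.+1 d.+2) (Seq (clear d)
      (Ite (Sees P) (Do (Inc A d)) (Do (Go A Stay)))))
  | Cond c a b => Seq (compile rs d c)
      (Ite (NonZero A d) (compile rs d a) (compile rs d b))
  | Rec n a s => Seq (compile rs d n) (Seq (clear d.+1) (Seq (compile rs d.+2 a)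
      (Seq (While (NonZero A d)
             (Seq (compile (d.+2 :: d.+1 :: rs) d.+3 s)
             (Seq (copy d.+2 d.+3 d.+4) (Seq (Do (Inc A d.+1)) (Do (Dec A d))))))
           (copy d d.+2 d.+3))))
  end.

(** Counts registers from [d] on, including the scratch registers of [copy] and [seek]. It depends
    on the term only, hence so does the number of work tapes. *)
Fixpoint room (e : term) : nat :=
  match e with
  | Var _ => 2
  | Zero | Top => 1
  | Succ e | Sym _ e => maxn (room e) 3
  | Cond c a b => maxn (maxn (room c) 1) (maxn (room a) (room b))
  | Rec n a s => maxn (maxn (room n) (room a).+2) (maxn (room s).+3 5)
  end.

(** * Total correctness of compiled terms *)

Section Correctness.
Variables (w : seq A) (m : nat).
Let B := (size w).+1.
Notation exec := (exec w m B).
Notation op_ok := (op_ok m B).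

Lemma seq_exec p q s (P Q : store -> Prop) :
  (exists2 s', exec p s s' & P s') ->
  (forall s', P s' -> exists2 s'', exec q s' s'' & Q s'') ->
  exists2 s', exec (Seq p q) s s' & Q s'.
Proof.
case=> s' ps Ps' /(_ _ Ps')[s'' qs Qs'']; exists s'' => //.
exact: Exec_Seq ps qs.
Qed.

Lemma do_exec o s (Q : store -> Prop) : op_ok o s -> Q (op_do w o s) ->
  exists2 s', exec (Do o) s s' & Q s'.
Proof. by move=> ok Qs; exists (op_do w o s) => //; apply: Exec_Do. Qed.

Lemma do_seq_exec o q s (Q : store -> Prop) : op_ok o s ->
  (exists2 s', exec q (op_do w o s) s' & Q s') ->
  exists2 s', exec (Seq (Do o) q) s s' & Q s'.
Proof.
move=> ok [s' qs' Qs']; exists s' => //.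
by apply: Exec_Seq qs'; apply: Exec_Do.
Qed.

Lemma ite_exec o p q s (Q : store -> Prop) : op_ok o s ->
  (exists2 s', exec (if op_res w o s then p else q) (op_do w o s) s' & Q s') ->
  exists2 s', exec (Ite o p q) s s' & Q s'.
Proof. by move=> ok [s' ss' Qs']; exists s' => //; apply: Exec_Ite. Qed.

(** The index of [I] is the number of rounds left, so [I] is invariant and variant at once. *)
Lemma while_exec o p (I : nat -> store -> Prop) n s :
  (forall i s, I i s -> [/\ op_ok o s, op_do w o s = s & op_res w o s = (i != 0)]) ->
  (forall i s, I i.+1 s -> exists2 s', exec p s s' & I i s') ->
  I n s -> exists2 s', exec (While o p) s s' & I 0 s'.
Proof.
move=> Itest Ibody; elim: n s => [|n IH] s Is; have [ok os res] := Itest _ _ Is.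
  by exists s => //; rewrite -{2}os; apply: Exec_end => //; rewrite res.
have [s' ss' /IH[s'' ss'' Is'']] := Ibody _ _ Is.
by exists s'' => //; apply: Exec_loop ss''; rewrite ?res ?os.
Qed.

Ltac upd_lia := rewrite /= /upd /=;
  repeat match goal with H : _ =1 _ |- _ =>
    try rewrite !H; rewrite /upd /=; clear H end;
  repeat match goal with |- context[if ?a == ?b then _ else _] =>
    case: (@eqP _ a b) => ?; subst; try lia end;
  try lia.
Ltac pointwise := let x := fresh "x" in move=> x; upd_lia.

Lemma clear_exec r s : r < m ->
  exists2 s', exec (clear r) s s' & s'.1 = s.1 /\ s'.2 =1 upd s.2 r 0.
Proof.
move=> rm; apply: (@while_exec _ _ (fun i s' => s'.1 = s.1 /\ s'.2 =1 upd s.2 r i) (s.2 r)).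
- by move=> i t [_ t2] /=; rewrite rm t2 /upd eqxx; case: t {t2}.
- move=> i t [t1 t2]; apply: do_exec => /=; first by rewrite rm t2 /upd eqxx.
  by split=> //; pointwise.
by split=> //; pointwise.
Qed.

Lemma copy_exec d k t s : d < m -> k < m -> t < m -> d != k -> t != k -> t != d ->
  s.2 k <= B ->
  exists2 s', exec (copy d k t) s s' &
    s'.1 = s.1 /\ s'.2 =1 upd (upd s.2 t 0) d (s.2 k).
Proof.
move=> dm km tm /eqP dk /eqP tk /eqP td vB.
apply: seq_exec (clear_exec s dm) _ => s1 [<- E1].
apply: seq_exec (clear_exec s1 tm) _ => s2 [<- E2].
apply: (@seq_exec _ _ _ (fun s' => s'.1 = s2.1 /\
    s'.2 =1 upd (upd s2.2 k 0) t (s.2 k))).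
  have [] := @while_exec (NonZero A k) (Seq (Do (Dec A k)) (Do (Inc A t)))
    (fun i s' => [/\ s'.1 = s2.1, i <= s.2 k &
      s'.2 =1 upd (upd s2.2 k i) t (s.2 k - i)]) (s.2 k) s2.
  - by move=> i u [_ _ E] /=; rewrite km; split=> //; upd_lia.
  - move=> i u [u1 iv E]; apply: do_seq_exec => /=; first by rewrite km; upd_lia.
    apply: do_exec => /=; first by rewrite tm; upd_lia.
    by split=> //; [lia|pointwise].
  - by split=> //; pointwise.
  by move=> s' run [s'1 _ E]; exists s' => //; split=> //; pointwise.
move=> s3 [<- E3].
have [] := @while_exec (NonZero A t)
  (Seq (Do (Dec A t)) (Seq (Do (Inc A k)) (Do (Inc A d))))
  (fun i s' => [/\ s'.1 = s3.1, i <= s.2 k &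
    s'.2 =1 upd (upd (upd s3.2 t i) k (s.2 k - i)) d (s.2 k - i)]) (s.2 k) s3.
- by move=> i u [_ _ E] /=; rewrite tm; split=> //; upd_lia.
- move=> i u [u1 iv E]; apply: do_seq_exec => /=; first by rewrite tm; upd_lia.
  apply: do_seq_exec => /=; first by rewrite km; upd_lia.
  apply: do_exec => /=; first by rewrite dm; upd_lia.
  by split=> //; [lia|pointwise].
- by split=> //; pointwise.
by move=> s' run [s'1 _ E]; exists s' => //; split=> //; pointwise.
Qed.

Lemma go_home_exec s :
  exists2 s', exec go_home s s' & s' = (0, s.2).
Proof.
(* Strong induction, because the head of an arbitrary store may lie beyond the right end marker, and
   then one move to the left is clamped by more than one cell. *)
case: s => h f; exists (0, f) => //=; elim/ltn_ind: h => -[_|h IH].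
  by apply: (@Exec_end _ _ _ _ (Sees (predC (@at_left A)))).
apply: (@Exec_loop _ _ _ _ (Sees (predC (@at_left A))) _ _ (minn h (size w).+1, f)) => //=.
- by case: onth.
- exact: (@Exec_Do _ w m B (Go A MoveLeft) (h.+1, f)).
by apply: IH; rewrite ltnS geq_minl.
Qed.

Lemma seek_exec r t t' s : r < m -> t < m -> t' < m ->
  t != r -> t' != r -> t' != t -> s.2 r <= B ->
  exists2 s', exec (seek r t t') s s' &
    s'.1 = s.2 r /\ s'.2 =1 upd (upd s.2 t' 0) t 0.
Proof.
move=> rm tm t'm tr t'r t't vB.
apply: seq_exec (copy_exec tm rm t'm tr t'r t't vB) _ => s1 [_ E1].
apply: seq_exec (go_home_exec s1) _ => _ ->.
have [] := @while_exec (NonZero A t) (Seq (Do (Dec A t)) (Do (Go A MoveRight)))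
  (fun i s' => [/\ i <= s.2 r, s'.1 = s.2 r - i & s'.2 =1 upd s1.2 t i])
  (s.2 r) (0, s1.2).
- by move=> i u [_ _ E] /=; rewrite tm; split=> //; upd_lia.
- move=> i u [iv u1 E]; apply: do_seq_exec => /=; first by rewrite tm; upd_lia.
  apply: do_exec => //=; split; [lia| |pointwise].
  by rewrite u1; move: vB; rewrite /B; lia.
- by split=> //=; [rewrite subnn|pointwise].
by move=> s' run [_ s'1 E]; exists s' => //; split; [rewrite s'1 subn0|pointwise].
Qed.

Lemma compile_exec e rs env d s :
  all (leq^~ B) env -> [seq s.2 r | r <- rs] = env -> all (ltn^~ d) rs ->
  d + room e <= m ->
  exists2 s', exec (compile rs d e) s s' &
    s'.2 d = eval w env e /\ forall k, k < d -> s'.2 k = s.2 k.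
Proof.
elim: e rs env d s => [k||| e IH|P e IH|c IHc a IHa b IHb|n IHn a IHa e IHe]
  rs env d s le_env rs_env rs_d /= dm.
- case: ifP => kr; last first.
    have [|s' ss' [_ E]] := @clear_exec d s; first by lia.
    exists s' => //; rewrite E /upd eqxx nth_default; last first.
      by rewrite -rs_env size_map leqNgt kr.
    by split=> // i ik; upd_lia.
  have rd : nth 0 rs k < d by apply: (all_nthP 0 rs_d).
  have ev : s.2 (nth 0 rs k) = nth 0 env k by rewrite -rs_env (nth_map 0).
  have [||||||| s' ss' [_ E]] := @copy_exec d (nth 0 rs k) d.+1 s; try by lia.
    by rewrite ev; apply: (eval_le (Var k) le_env).
  by exists s' => //; rewrite -ev; split=> [|i ik]; upd_lia.
- have [|s' ss' [_ E]] := @clear_exec d s; first by lia.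
  by exists s' => //; split=> [|i ik]; upd_lia.
- apply: seq_exec (@clear_exec d s _) _; first by lia.
  move=> s1 [_ E1]; apply: seq_exec (go_home_exec s1) _ => _ ->.
  have [] := @while_exec (Sees (predC (@at_right A)))
    (Seq (Do (Go A MoveRight)) (Do (Inc A d)))
    (fun i s' => [/\ i <= B, s'.1 = B - i & s'.2 =1 upd s1.2 d (B - i)]) B (0, s1.2).
  + move=> i u [iB u1 _]; split=> //=; rewrite at_rightE u1 -leqNgt.
    by rewrite /B; apply/idP/idP; lia.
  + move=> i u [iB u1 E]; apply: do_seq_exec => //=.
    apply: do_exec; first by apply/andP; split; [lia|upd_lia].
    split; [lia|rewrite /= u1 /B; lia|pointwise].
  + by split=> //=; [rewrite subnn|pointwise].
  move=> s' run [_ _ E]; exists s' => //; rewrite subn0 in E.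
  by split=> [|i ik]; upd_lia.
(* The input tape serves as the ruler for the cap: with the head at the position given by the value,
   the right end marker is seen exactly when the value is [B]. *)
- apply: seq_exec (IH rs env d s le_env rs_env rs_d _) _; first by lia.
  move=> s1 [ev fr1]; have eB := eval_le e le_env.
  apply: seq_exec (@seek_exec d d.+1 d.+2 s1 _ _ _ _ _ _ _) _; try lia.
  rewrite ev => s2 [s21 E2]; apply: ite_exec => //=; rewrite at_rightE s21.
  case: ifP => lt; apply: do_exec => //=.
  + by split=> [|i ik]; [upd_lia|rewrite -fr1 //; upd_lia].
  + by apply/andP; split; [lia|upd_lia].
  by split=> [|i ik]; [upd_lia|rewrite -fr1 //; upd_lia].
- apply: seq_exec (IH rs env d s le_env rs_env rs_d _) _; first by lia.
  move=> s1 [ev fr1]; have eB := eval_le e le_env.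
  apply: seq_exec (@seek_exec d d.+1 d.+2 s1 _ _ _ _ _ _ _) _; try lia.
  rewrite ev => s2 [s21 E2].
  apply: seq_exec (@clear_exec d s2 _) _ => [|s3 [s31 E3]]; first by lia.
  apply: ite_exec => //=; rewrite s31 s21; case: ifP => Pe; apply: do_exec => //=.
  + by apply/andP; split; [lia|upd_lia].
  + by split=> [|i ik]; [upd_lia|rewrite -fr1 //; upd_lia].
  by split=> [|i ik]; [upd_lia|rewrite -fr1 //; upd_lia].
- apply: seq_exec (IHc rs env d s le_env rs_env rs_d _) _; first by lia.
  move=> s1 [ev fr1]; apply: ite_exec => /=; first by lia.
  have rs_env1 : [seq s1.2 r | r <- rs] = env.
    by rewrite -rs_env; apply/eq_in_map => r /(allP rs_d); apply: fr1.
  rewrite ev; case: ifP => _.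
    have [|s' ss' [ev' fr']] := IHa rs env d s1 le_env rs_env1 rs_d; first by lia.
    by exists s' => //; split=> // i ik; rewrite fr' ?fr1.
  have [|s' ss' [ev' fr']] := IHb rs env d s1 le_env rs_env1 rs_d; first by lia.
  by exists s' => //; split=> // i ik; rewrite fr' ?fr1.
apply: seq_exec (IHn rs env d s le_env rs_env rs_d _) _; first by lia.
move=> s1 [ev1 fr1]; set N := eval w env n in ev1 *.
have NB : N <= B := eval_le n le_env.
apply: seq_exec (@clear_exec d.+1 s1 _) _; first by lia.
move=> s2 [_ E2].
have regs (t : store) : (forall k, k < d -> t.2 k = s.2 k) -> [seq t.2 r | r <- rs] = env.
  by move=> fr; rewrite -rs_env; apply/eq_in_map => r /(allP rs_d); apply: fr.
have fr2 k : k < d -> s2.2 k = s.2 k by move=> kd; rewrite -fr1 //; upd_lia.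
have rs_d' d' : d <= d' -> all (ltn^~ d') rs.
  by move=> dd'; apply: sub_all rs_d => r /= rd; apply: leq_trans dd'.
apply: seq_exec (IHa rs env d.+2 s2 le_env (regs s2 fr2) (rs_d' _ _) _) _; try lia.
move=> s3 [ev3 fr3].
pose val i := iteri i (fun i x => eval w (x :: i :: env) e) (eval w env a).
have val_le i : i <= N -> val i <= B.
  elim: i => [|i IH] iN; first exact: eval_le.
  by apply: eval_le; rewrite /= le_env IH ltnW // (leq_trans iN).
(* In the loop, [d] counts the rounds left and [d.+1] the rounds done, while [d.+2] is the
   accumulator. *)
apply: (@seq_exec _ _ _ (fun t => t.2 d.+2 = val N /\ forall k, k < d -> t.2 k = s.2 k)).
  have [] := @while_exec (NonZero A d)
      (Seq (compile (d.+2 :: d.+1 :: rs) d.+3 e)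
         (Seq (copy d.+2 d.+3 d.+4) (Seq (Do (Inc A d.+1)) (Do (Dec A d)))))
    (fun i t => [/\ i <= N, t.2 d = i, t.2 d.+1 = N - i, t.2 d.+2 = val (N - i) &
      forall k, k < d -> t.2 k = s.2 k]) N s3.
  - by move=> i t [_ td _ _ _]; rewrite /= td; split=> //; lia.
  - move=> i t [iN td td1 td2 fr].
    have le_env' : all (leq^~ B) [:: val (N - i.+1), N - i.+1 & env].
      by rewrite /= le_env val_le ?leq_subr // (leq_trans (leq_subr _ _) NB).
    apply: seq_exec (IHe [:: d.+2, d.+1 & rs] _ d.+3 t le_env' _ _ _) _.
    + by rewrite /= td1 td2 regs.
    + by rewrite /= rs_d' ?andbT; lia.
    + by lia.
    move=> t1 [ev4 fr4].
    have ev5 : t1.2 d.+3 = val (N - i) by rewrite ev4 -(subnSK iN).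
    apply: seq_exec (@copy_exec d.+2 d.+3 d.+4 t1 _ _ _ _ _ _ _) _; try lia.
      by rewrite ev5 val_le ?leq_subr.
    move=> t2 [_ E]; rewrite ev5 in E.
    have td' : t1.2 d = i.+1 by rewrite fr4 //; lia.
    have td1' : t1.2 d.+1 = N - i.+1 by rewrite fr4 //; lia.
    have fr' k : k < d -> t1.2 k = s.2 k by move=> kd; rewrite fr4 ?fr //; lia.
    apply: do_seq_exec; first by apply/andP; split; [lia|upd_lia].
    apply: do_exec; first by apply/andP; split; [lia|upd_lia].
    split; [by lia|upd_lia|upd_lia|upd_lia|].
    by move=> k kd; rewrite -fr' //; upd_lia.
  - split=> //; rewrite ?subnn //.
    + by rewrite fr3 //; upd_lia.
    + by rewrite fr3 //; upd_lia.
    by move=> k kd; rewrite fr3 ?fr2 //; lia.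
  by move=> t run [_ _ _ t2 fr]; exists t => //; split=> //; rewrite t2 subn0.
move=> s4 [ev4 fr4].
have [||||||| s' ss' [_ E]] := @copy_exec d d.+2 d.+3 s4; try by lia.
  by rewrite ev4 val_le.
exists s' => //; rewrite ev4 in E; split=> [|i ik]; first by upd_lia.
by rewrite -fr4 //; upd_lia.
Qed.

End Correctness.

(* B = |w| + 1 < 2 ^ (trunc_log 2 |w| + 2), so counters of that many bits,
   with one blank cell on either side, suffice. *)
Theorem term_NL (e : term) : NL (fun w => eval w [::] e != 0).
Proof.
(* With L the logarithm of |w|, counters of L + 2 bits take L + 4 cells, which is at most 4 (L +
   1). *)
exists (machine (Seq (compile [::] 0 e) (Do (NonZero A 0))) (room e)), 4 => w.
have le_room : 0 + room e <= (room e).+1 by lia.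
have [[h f] run [/= ev _]] :=
  @compile_exec w (room e).+1 e [::] [::] 0 (0, fun=> 0) isT erefl isT le_room.
set K := (trunc_log 2 (size w)).+1.
have BK : (size w).+1 < 2 ^ K.+1.
  by have := trunc_log_ltn (size w) (isT : 1 < 2); rewrite -/K expnS; lia.
have [hl sp ac] := machine_correct BK run; rewrite ev in ac.
split=> // c cr i; apply: leq_trans (sp c cr i) _; lia.
Qed.

End Terms.

Arguments Var {A} k : rename.
Arguments Zero {A}.
Arguments Top {A}.

(** * Arithmetic, connectives and bounded quantifiers as terms *)

Section DerivedTerms.
Variable A : finType.
Implicit Types (a b e n : term A).

(* Makes room for the two variables bound by [Rec]. *)
Fixpoint lift_from c e : term A :=
  match e with
  | Var k => Var (if k < c then k else k.+2)
  | Zero => Zero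
  | Top => Top
  | Succ e => Succ (lift_from c e)
  | Sym P e => Sym P (lift_from c e)
  | Cond a b e => Cond (lift_from c a) (lift_from c b) (lift_from c e)
  | Rec n a s => Rec (lift_from c n) (lift_from c a) (lift_from c.+2 s)
  end.
Definition lift := lift_from 0.

Definition One : term A := Succ Zero.
Definition Not e := Cond e Zero One.
Definition And a b := Cond a b Zero.
Definition Imp a b := Cond a b One.
(** Each round stores its own index, so the last of [e] rounds leaves [e - 1]. *)
Definition Pred e := Rec e Zero (Var 1).
Definition Sub a b := Rec b a (Pred (Var 0)).
Definition Leq a b := Not (Sub a b).
Definition Eq a b := And (Leq a b) (Leq b a).
Definition Add a b := Rec b a (Succ (Var 0)).

(* In [f], the quantified variable has index 1, and index 0 is reserved. *)
Definition All n f := Rec n One (Cond f (Var 0) Zero).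
Definition Ex n f := Not (All n (Not f)).

Variable w : seq A.
Let B := (size w).+1.
Notation ev := (eval w).

Lemma eval_liftfrom env1 x i env2 e :
  ev (env1 ++ x :: i :: env2) (lift_from (size env1) e) = ev (env1 ++ env2) e.
Proof.
elim: e env1 => [k||| e IH|P e IH|a IHa b IHb e IHe|n IHn a IHa e IHe] env1 //=.
- rewrite !nth_cat; case: (ltnP k) => [->|kn] //.
  by rewrite ltnNge (leq_trans kn) ?leqW //= !subSn // ltnW.
- by rewrite IH.
- by rewrite IH.
- by rewrite IHa IHb IHe.
rewrite IHn IHa; apply: eq_iteri => j y.
by rewrite -[_ :: _ :: env1 ++ _]/([:: y, j & env1] ++ _) IHe.
Qed.

Lemma eval_lift env x i e : ev [:: x, i & env] (lift e) = ev env e.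
Proof. exact: (eval_liftfrom [::]). Qed.

Lemma eval_One env : ev env (One) = 1.
Proof. by rewrite /=; lia. Qed.

Lemma eval_Cond env c a b :
  ev env (Cond c a b) = if ev env c != 0 then ev env a else ev env b.
Proof. by []. Qed.

Lemma eval_Rec env n a e : ev env (Rec n a e) =
  iteri (ev env n) (fun i x => ev [:: x, i & env] e) (ev env a).
Proof. by []. Qed.

Lemma eval_Not env e : (ev env (Not e) != 0) = (ev env e == 0).
Proof. by rewrite eval_Cond eval_One; case: (ev env e). Qed.

Lemma eval_And env a b : (ev env (And a b) != 0) = (ev env a != 0) && (ev env b != 0).
Proof. by rewrite /=; case: ifP. Qed.

Lemma eval_Imp env a b : (ev env (Imp a b) != 0) = (ev env a != 0) ==> (ev env b != 0).
Proof. by rewrite eval_Cond eval_One; case: ifP. Qed.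

Lemma eval_Pred env e : ev env (Pred e) = (ev env e).-1.
Proof. by rewrite /=; case: (ev env e). Qed.

Lemma eval_Sub env a b : ev env (Sub a b) = ev env a - ev env b.
Proof.
rewrite [LHS]/=; elim: (ev env b) => [|i IH]; first by rewrite subn0.
by rewrite subnS -IH iteriS; case: (iteri i _ _).
Qed.

Lemma eval_Leq env a b : (ev env (Leq a b) != 0) = (ev env a <= ev env b).
Proof. by rewrite eval_Not eval_Sub. Qed.

Lemma eval_Eq env a b : (ev env (Eq a b) != 0) = (ev env a == ev env b).
Proof. by rewrite eval_And !eval_Leq -eqn_leq. Qed.

Lemma eval_Add env a b : ev env a <= B -> ev env (Add a b) = minn (ev env a + ev env b) B.
Proof.
move=> aB; rewrite /=; elim: (ev env b) => [|i /= ->].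
  by rewrite addn0; apply/esym/minn_idPl.
by rewrite -/B; lia.
Qed.

Lemma eval_All env n f (P : pred nat) :
  (forall x i, i < ev env n -> (ev [:: x, i & env] f != 0) = P i) ->
  (ev env (All n f) != 0) = all P (iota 0 (ev env n)).
Proof.
move=> fP; rewrite /All; move: (One) (eval_One env) => one /= ->.
have: forall i, i < ev env n -> forall x, (ev [:: x, i & env] f != 0) = P i.
  by move=> i iN x; apply: fP.
elim: (ev env n) => [|i IH] // {}fP.
rewrite -[X in iota 0 X]addn1 iotaD all_cat /= andbT -IH ?fP //.
  by case: (P i); rewrite ?andbT ?andbF.
by move=> j ji; apply: fP; apply: ltnW.
Qed.

Lemma eval_All_ord env n f m (P : pred 'I_m) : ev env n = m ->
  (forall x (i : 'I_m), (ev [:: x, i : nat & env] f != 0) = P i) ->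
  (ev env (All n f) != 0) = [forall i, P i].
Proof.
(* [P] is defined only below [m]; the value of [f] at an arbitrary accumulator, here 0, extends it
   to all numbers. *)
move=> nm fP; rewrite (@eval_All _ _ _ (fun k => ev [:: 0, k & env] f != 0)).
  rewrite nm; apply/allP/forallP => [all i|all i].
    by rewrite -(fP 0); apply: all; rewrite mem_iota ltn_ord.
  by rewrite mem_iota /= add0n => im; rewrite (fP _ (Ordinal im)).
by rewrite nm => x i im; rewrite !(fP _ (Ordinal im)).
Qed.

Lemma eval_Ex_ord env n f m (P : pred 'I_m) : ev env n = m ->
  (forall x (i : 'I_m), (ev [:: x, i : nat & env] f != 0) = P i) ->
  (ev env (Ex n f) != 0) = [exists i, P i].
Proof.
move=> nm fP; rewrite eval_Not -[_ == 0]negbK (@eval_All_ord _ _ _ m (predC P)) //.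
  by rewrite negb_forall; apply: eq_existsb => i; rewrite /= negbK.
by move=> x i; rewrite eval_Not /= -(fP x) negbK.
Qed.

End DerivedTerms.

(** * Reading tables *)

Definition is_letter (l : letter) (x : input_symbol letter) : bool :=
  if x is InputSymbol l' then l' == l else false.

Definition Is (l : letter) (e : term letter) := Sym (is_letter l) e.

(* The terms [Val p], [Ent p] and [Tbl p] give the binary number that ends just
   before position [p], the number of entries before [p] in the same table, and
   the number of tables ended before [p], all capped by the value of [Top]. *)
Definition Val (p : term letter) := Rec p Zero
  (Cond (Is (Bit true) (Var 1)) (Succ (Add (Var 0) (Var 0)))
  (Cond (Is (Bit false) (Var 1)) (Add (Var 0) (Var 0)) Zero)).
Definition Ent (p : term letter) := Rec p Zero
  (Cond (Is EndEntry (Var 1)) (Succ (Var 0))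
  (Cond (Is EndTable (Var 1)) Zero (Var 0))).
Definition Tbl (p : term letter) := Rec p Zero
  (Cond (Is EndTable (Var 1)) (Succ (Var 0)) (Var 0)).

(* Tables and points are counted from 0 here, whereas the entries of the input
   are points counted from 1, whence the [Pred]. *)
Definition Image (i x : term letter) := Rec Top Zero
  (Cond (And (Is EndEntry (Var 1))
          (And (Eq (Tbl (Var 1)) (lift i)) (Eq (Ent (Var 1)) (lift x))))
     (Pred (Val (Var 1))) (Var 0)).

Definition Last : term letter := Pred Top.
(** The last letter should close the last table, so this is the length of that table; [Well_formed]
    compares all tables with it. *)
Definition Degree := Ent Last.
Definition Rank := Tbl Top.

Definition Well_formed := And (Is EndTable Last) (And Degree
  (All Top
    (And (Imp (Is (Bit false) (Var 1)) (Val (Var 1)))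
    (And (Imp (Is EndEntry (Var 1))
            (And (Val (Var 1)) (Leq (Val (Var 1)) Degree)))
         (Imp (Is EndTable (Var 1))
            (And (Not (Val (Var 1))) (Eq (Ent (Var 1)) Degree))))))).

Section Reading.
Variable w : seq letter.
Let B := (size w).+1.
Notation ev := (eval w).
Notation letter_at q := (nth EndTable w q).

Definition val_step v l := if l is Bit b then minn (v.*2 + b) B else 0.
Definition ent_step c l :=
  match l with EndEntry => minn c.+1 B | EndTable => 0 | Bit _ => c end.
Definition tbl_step t l := if l is EndTable then minn t.+1 B else t.
Definition image_step i x (s : nat * nat * nat * nat) l :=
  let: (v, c, t, y) := s in
  (val_step v l, ent_step c l, tbl_step t l,
   if [&& l == EndEntry, t == i & c == x] then v.-1 else y).

Lemma eval_Is env l e q : ev env e = q.+1 -> q < size w ->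
  (ev env (Is l e) != 0) = (letter_at q == l).
Proof.
move=> /= -> qw; rewrite /= (_ : onth w q = Some (letter_at q)).
  by rewrite /is_letter; case: (_ == l).
by elim: w q qw => //= x s IH [|q] //=; apply: IH.
Qed.

Lemma eval_Is0 env l e : ev env e = 0 -> (ev env (Is l e) != 0) = false.
Proof. by move=> /= ->. Qed.

(** Round 0 reads the left end marker and leaves 0, so [p.+1] rounds treat [p] letters. The bound is
    carried along because [F] and [f] need to agree on capped values only. *)
Lemma iteri_foldl F f p :
  F 0 0 = 0 ->
  (forall q x, q < size w -> x <= B -> F q.+1 x = f x (letter_at q)) ->
  (forall x l, x <= B -> f x l <= B) ->
  p <= size w -> iteri p.+1 F 0 = foldl f 0 (take p w).
Proof.
move=> F0 Ff fB pw; suff [] : iteri p.+1 F 0 = foldl f 0 (take p w) /\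
  foldl f 0 (take p w) <= B by [].
elim: p pw => [|p IH] pw; first by rewrite take0 /= F0.
rewrite (take_nth EndTable) // foldl_rcons; have [<- le] := IH (ltnW pw).
by rewrite [iteri _ _ _]iteriS Ff //; split=> //; apply: fB.
Qed.

Lemma eval_Val env e p : ev env e = p.+1 -> p <= size w ->
  ev env (Val e) = foldl val_step 0 (take p w).
Proof.
move=> ep pw; rewrite eval_Rec ep.
apply: iteri_foldl => // [q x qw xB|x l xB].
  rewrite !eval_Cond !(@eval_Is _ _ _ q) //; move: (letter_at q) => l.
  have -> env' : ev env' (Succ (Add (Var 0) (Var 0))) =
    minn (ev env' (Add (Var 0) (Var 0))).+1 B by [].
  rewrite eval_Add //= -/B /val_step.
  by case: l => [[]||] //=; rewrite addnn; lia.
by rewrite /val_step; case: l => // b; apply: geq_minr.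
Qed.

Lemma eval_Ent env e p : ev env e = p.+1 -> p <= size w ->
  ev env (Ent e) = foldl ent_step 0 (take p w).
Proof.
move=> ep pw; rewrite eval_Rec ep.
apply: iteri_foldl => // [q x qw xB|x l xB].
  by rewrite !eval_Cond !(@eval_Is _ _ _ q) //; case: (letter_at q).
by rewrite /ent_step; case: l => // ; apply: geq_minr.
Qed.

Lemma eval_Tbl env e p : ev env e = p.+1 -> p <= size w ->
  ev env (Tbl e) = foldl tbl_step 0 (take p w).
Proof.
move=> ep pw; rewrite eval_Rec ep.
apply: iteri_foldl => // [q x qw xB|x l xB].
  by rewrite !eval_Cond !(@eval_Is _ _ _ q) //; case: (letter_at q).
by rewrite /tbl_step; case: l => // ; apply: geq_minr.
Qed.

(** The term recomputes [Tbl], [Ent] and [Val] at each position; one fold carrying the three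
    counters and the entry found so far is better suited to induction on the encoding. *)
Lemma eval_Image env i x : ev env (Image i x) =
  (foldl (image_step (ev env i) (ev env x)) (0, 0, 0, 0) w).2.
Proof.
rewrite eval_Rec -[ev env Top]/B.
set F := fun _ _ => _; set f := image_step _ _.
suff fold p : p <= size w -> foldl f (0, 0, 0, 0) (take p w) =
    (foldl val_step 0 (take p w), foldl ent_step 0 (take p w),
     foldl tbl_step 0 (take p w), iteri p.+1 F 0).
  by have := fold _ (leqnn _); rewrite take_size => ->.
elim: p => [|p IH] pw; first by rewrite take0 /= /F eval_Cond eval_And eval_Is0.
rewrite (take_nth EndTable pw) !foldl_rcons.
rewrite (IH (ltnW pw)).
rewrite [iteri p.+2 F 0]iteriS; set y := iteri p.+1 F 0; congr (_, _).
rewrite /F eval_Cond 2!eval_And !eval_Eq !eval_lift (@eval_Is _ _ _ p) //.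
by rewrite eval_Pred (@eval_Tbl _ _ p) ?(@eval_Ent _ _ p) ?(@eval_Val _ _ p) // ltnW.
Qed.

(* What the [Well_formed] test requires of a letter [l] that follows a number
   with value [v] and [c] entries of its table. *)
Definition letter_ok n v c l :=
  match l with
  | Bit b => b || (v != 0)
  | EndEntry => 0 < v <= n
  | EndTable => (v == 0) && (c == n)
  end.

Fixpoint word_ok n v c s :=
  if s is l :: s' then
    letter_ok n v c l && word_ok n (val_step v l) (ent_step c l) s'
  else true.

Lemma word_ok_all n u s : w = u ++ s ->
  word_ok n (foldl val_step 0 u) (foldl ent_step 0 u) s =
  all (fun q => letter_ok n (foldl val_step 0 (take q w))
                  (foldl ent_step 0 (take q w)) (letter_at q))
      (iota (size u) (size s)).
Proof.
elim: s u => // l s IH u wE; rewrite [LHS]/= [RHS]/=; congr (_ && _).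
  by rewrite wE take_size_cat // nth_cat ltnn subnn.
by rewrite -!foldl_rcons IH ?size_rcons // wE cat_rcons.
Qed.

Lemma eval_Degree env : w != [::] ->
  ev env Degree = foldl ent_step 0 (take (size w).-1 w).
Proof.
rewrite -size_eq0 -lt0n => w0; apply: eval_Ent; last exact: leq_pred.
by rewrite eval_Pred /= prednK.
Qed.

Lemma eval_Rank env : ev env Rank = foldl tbl_step 0 w.
Proof. by rewrite (@eval_Tbl _ _ (size w)) // take_size. Qed.

Lemma eval_Well_formed :
  (ev [::] Well_formed != 0) =
  [&& w != [::], last EndTable w == EndTable, ev [::] Degree != 0
    & word_ok (ev [::] Degree) 0 0 w].
Proof.
rewrite 2!eval_And; have [w0|w0] := eqVneq w [::].
  by rewrite eval_Is0 // eval_Pred /= w0.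
have w_gt0 : 0 < size w by rewrite lt0n size_eq0.
rewrite (@eval_Is _ _ _ (size w).-1) ?eval_Pred ?prednK //.
rewrite nth_last; congr [&& _, _ & _].
have deg env : ev env Degree = ev [::] Degree by rewrite !eval_Degree.
(* Position 0 is the left end marker, where all tests hold vacuously; letter [q] is at position
   [q.+1]. *)
pose P p := if p is q.+1 then letter_ok (ev [::] Degree)
  (foldl val_step 0 (take q w)) (foldl ent_step 0 (take q w)) (letter_at q) else true.
rewrite (@word_ok_all _ [::]) //.
rewrite (@eval_All _ w [::] Top _ P); last first.
  move=> x [|q] qw.
    by rewrite eval_And eval_Imp eval_Is0 // eval_And !eval_Imp !eval_Is0.
  rewrite /P eval_And eval_Imp (@eval_Is _ _ _ q) //.
  rewrite eval_And !eval_Imp !(@eval_Is _ _ _ q) // 2!eval_And eval_Leq eval_Eq eval_Not.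
  have qw' := ltnW qw : q <= size w.
  rewrite !(@eval_Val _ _ q) // (@eval_Ent _ _ q) // !deg.
  by rewrite /letter_ok; case: (letter_at q) => [[]||]; rewrite /= ?lt0n ?andbT.
rewrite -[ev [::] Top]/B -[iota 0 B]/(0 :: iota (1 + 0) (size w)) iotaDl /=.
by rewrite all_map.
Qed.

End Reading.

(** * The encoding *)

Section Binary.
Implicit Types (m v : nat) (bs : seq bool).

Definition bits_value v bs := foldl (fun v (b : bool) => v.*2 + b) v bs.

Lemma bits_value_ge v bs : v <= bits_value v bs.
Proof. by elim: bs v => //= b bs IH v; apply: leq_trans (IH _); lia. Qed.

Lemma binary_rcons m (b : bool) : 0 < m -> binary (m.*2 + b) = rcons (binary m) b.
Proof.
move=> m0; have half : (m.*2 + b)./2 = m by case: b; lia.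
rewrite /binary trunc_log2S; last by lia.
rewrite half /mkseq -[iota 0 _.+2]/(0 :: iota (1 + 0) (trunc_log 2 m).+1).
rewrite iotaDl map_cons -map_comp rev_cons.
rewrite divn1 oddD odd_double oddb; congr (rcons (rev _) _); apply: eq_map => j /=.
by rewrite add1n expnS divnMA divn2 half.
Qed.

Lemma binary_bits_value bs : binary (bits_value 1 bs) = true :: bs.
Proof.
elim/last_ind: bs => [|bs b IH]; first by [].
by rewrite /bits_value foldl_rcons binary_rcons ?bits_value_ge // IH.
Qed.

Lemma bits_valueP m : 0 < m -> exists2 bs, binary m = true :: bs & bits_value 1 bs = m.
Proof.
move=> m0; suff [bs <-] : exists bs, bits_value 1 bs = m.
  by exists bs => //; apply: binary_bits_value.
elim/ltn_ind: m m0 => -[|[|m]] // IH _; first by exists [::].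
have [||bs e] := IH m.+2./2; [by lia|by lia|].
exists (rcons bs (odd m.+2)); rewrite /bits_value foldl_rcons -/(bits_value 1 bs) e.
by rewrite addnC odd_double_half.
Qed.

End Binary.

Section Encoding.
Variable w : seq letter.
Let B := (size w).+1.
Notation val_step := (val_step w).
Notation ent_step := (ent_step w).
Notation tbl_step := (tbl_step w).
Notation image_step := (image_step w).
Notation word_ok := (word_ok w).
Implicit Types (bs : seq bool) (v c t y : nat).

(** Further digits never decrease a value, so capping after each digit amounts to capping once at
    the end. *)
Lemma foldl_val_bits v bs : v <= B ->
  foldl val_step v (map Bit bs) = minn (bits_value v bs) B.
Proof.
elim: bs v => [|b bs IH] v vB /=; first by apply/esym/minn_idPl.
rewrite IH ?geq_minr // -/B; case: (leqP (v.*2 + b) B) => // lt.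
by have := bits_value_ge B bs; have := bits_value_ge (v.*2 + b) bs; lia.
Qed.

Lemma image_step_bits i x v c t y bs :
  foldl (image_step i x) (v, c, t, y) (map Bit bs) =
  (foldl val_step v (map Bit bs), c, t, y).
Proof. by elim: bs v => //= b bs IH v; rewrite IH. Qed.

Lemma image_step_proj i x v c t y s :
  (foldl (image_step i x) (v, c, t, y) s).1 =
  (foldl val_step v s, foldl ent_step c s, foldl tbl_step t s).
Proof. by elim: s v c t y => //= l s IH v c t y; rewrite IH. Qed.

Lemma foldl_ent_le c s : foldl ent_step c s <= c + size s.
Proof.
elim: s c => [|l s IH] c /=; first by rewrite addn0.
by apply: leq_trans (IH _) _; case: l => [b||] /=; lia.
Qed.

Lemma word_ok_cat n v c s1 s2 : word_ok n v c (s1 ++ s2) =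
  word_ok n v c s1 && word_ok n (foldl val_step v s1) (foldl ent_step c s1) s2.
Proof. by elim: s1 v c => //= l s1 IH v c; rewrite IH andbA. Qed.

Lemma word_ok_bits n v c bs : 0 < v -> word_ok n v c (map Bit bs).
Proof.
elim: bs v => //= b bs IH v v0; rewrite -lt0n v0 orbT /=.
by apply: IH; rewrite -/B; lia.
Qed.

Section Degree.
Variables (n : nat).
Hypothesis nB : n < B.
Implicit Type (j : 'I_n) (f : transf n).

Lemma foldl_val_binary j : foldl val_step 0 (map Bit (binary j.+1)) = j.+1.
Proof.
have [bs -> ev] := bits_valueP (ltn0Sn j).
rewrite foldl_val_bits // /bits_value /= -/(bits_value 1 bs) ev.
by apply/minn_idPl; apply: leq_trans (ltn_ord j) (ltnW nB).
Qed.

Lemma image_step_point i x c t y j : c < B ->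
  foldl (image_step i x) (0, c, t, y) (encode_point j) =
  (0, c.+1, t, if (t == i) && (c == x) then j : nat else y).
Proof.
move=> cB; rewrite foldl_rcons image_step_bits foldl_val_binary /=.
by rewrite (minn_idPl _).
Qed.

Lemma image_step_points i x c t y (js : seq 'I_n) : c + size js <= B ->
  foldl (image_step i x) (0, c, t, y) (flatten (map (@encode_point n) js)) =
  (0, c + size js, t,
   if (t == i) && (c <= x < c + size js) then nth 0 (map val js) (x - c) else y).
Proof.
elim: js c y => [|j js IH] c y /= cB.
  by rewrite addn0; case: ifP => //; lia.
rewrite foldl_cat image_step_point; last by lia.
rewrite IH; last by lia.
rewrite addSnnS; congr (_, _); case: eqP => //= _.
case: (ltngtP c x) => [cx|//|<-]; first by rewrite -(subnSK cx).
by rewrite subnn -addSnnS leq_addr.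
Qed.

Definition table f : seq nat := [seq val (f x) | x <- enum 'I_n].

Lemma table_nth f (x : 'I_n) : nth 0 (table f) x = f x.
Proof. by rewrite (nth_map x) ?size_enum_ord // nth_ord_enum. Qed.

Lemma image_step_transf i x t y f : t < B ->
  foldl (image_step i x) (0, 0, t, y) (encode_transf f) =
  (0, 0, t.+1, if (t == i) && (x < n) then nth 0 (table f) x else y).
Proof.
move=> tB; rewrite /encode_transf (map_comp (@encode_point n) f) foldl_rcons.
rewrite image_step_points size_map size_enum_ord ?(ltnW nB) //=.
by rewrite (minn_idPl _) // -map_comp subn0.
Qed.

Lemma image_step_encode i x t y (fs : seq (transf n)) : t + size fs <= B ->
  foldl (image_step i x) (0, 0, t, y) (encode fs) =
  (0, 0, t + size fs, if (t <= i < t + size fs) && (x < n) then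
     nth 0 (nth [::] (map table fs) (i - t)) x else y).
Proof.
elim: fs t y => [|f fs IH] t y /= tB.
  by rewrite addn0; case: ifP => //; lia.
rewrite [encode _]/= foldl_cat image_step_transf; last by lia.
rewrite IH; last by lia.
rewrite addSnnS; congr (_, _).
case: (ltngtP t i) => [ti|//|<-]; first by rewrite -(subnSK ti).
by rewrite subnn -addSnnS leq_addr.
Qed.

Lemma word_ok_points c (js : seq 'I_n) : c + size js <= B ->
  word_ok n 0 c (flatten (map (@encode_point n) js)).
Proof.
elim: js c => //= j js IH c cB; rewrite word_ok_cat.
(* Projecting a run of [image_step] with dummy parameters 0 gives both counters after a point. *)
have /= := image_step_proj 0 0 0 c 0 0 (encode_point j).
rewrite image_step_point; last by lia.
case=> <- <- _; rewrite IH ?addSnnS // andbT /encode_point -cats1 word_ok_cat.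
rewrite foldl_val_binary /= ltn_ord !andbT.
have [bs -> _] := bits_valueP (ltn0Sn j).
by rewrite /= word_ok_bits //= -/B; lia.
Qed.

Lemma word_ok_encode (fs : seq (transf n)) : word_ok n 0 0 (encode fs).
Proof.
elim: fs => //= f fs IH; rewrite [encode _]/= word_ok_cat.
have /= := image_step_proj 0 0 0 0 0 0 (encode_transf f).
rewrite image_step_transf // => -[<- <- _]; rewrite IH andbT.
rewrite /encode_transf (map_comp (@encode_point n) f) -cats1 word_ok_cat.
have /= := image_step_proj 0 0 0 0 0 0
  (flatten (map (@encode_point n) (map f (enum 'I_n)))).
rewrite image_step_points size_map size_enum_ord ?(ltnW nB) // => -[<- <- _].
rewrite word_ok_points /=; first by rewrite add0n eqxx.
by rewrite size_map size_enum_ord ltnW.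
Qed.

Lemma encode_cons (js : seq 'I_n) (fs : seq (transf n)) : size js = n ->
  exists f, flatten (map (@encode_point n) js) ++ EndTable :: encode fs = encode (f :: fs).
Proof.
move=> js_n; pose f : transf n := [ffun x : 'I_n => nth x js x]; exists f.
have fE : map f (enum 'I_n) = js.
  have sz : size (map f (enum 'I_n)) = n by rewrite size_map size_enum_ord.
  apply: (inj_map val_inj); apply: (@eq_from_nth _ 0) => [|i]; rewrite !size_map.
    by rewrite -enumT size_enum_ord.
  rewrite -enumT size_enum_ord => iN; pose x := Ordinal iN.
  rewrite (nth_map x) ?sz // (nth_map x) ?size_enum_ord // (nth_ord_enum x x) ffunE.
  by rewrite (nth_map x) ?js_n.
rewrite -[encode (f :: fs)]/(encode_transf f ++ encode fs) /encode_transf.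
by rewrite (map_comp (@encode_point n) f) fE cat_rcons.
Qed.

(** Converse of [word_ok_encode], generalized to a suffix read in any state: [e] completes the
    number in progress, [js] the current table, and [fs] are the later tables. A number is in
    progress exactly when [v] is nonzero, as leading zeros are excluded. *)
Lemma parse s v c : v <= B -> word_ok n v c s -> s != [::] ->
    last EndTable s = EndTable ->
  exists e (js : seq 'I_n) (fs : seq (transf n)),
    let r := flatten (map (@encode_point n) js) ++ EndTable :: encode fs in
    if v == 0 then s = r /\ c + size js = n
    else [/\ s = map Bit e ++ EndEntry :: r, c.+1 + size js = n
            & 0 < bits_value v e <= n].
Proof.
elim: s v c => // l s IH v c vB /= /andP[lok sok] _ lst.
case: l lok sok lst => [b||] /= lok sok lst.
- have s0 : s != [::] by apply: contra_eq_neq lst => ->.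
  have lst' : last EndTable s = EndTable by case: (s) s0 lst.
  set v' := minn _ _ in sok.
  have v'0 : (v' == 0) = false by rewrite /v'; case: (b) (v) lok => [] [|?] //=; lia.
  have [|e [js [fs]]] := IH v' c _ sok s0 lst'; first exact: geq_minr.
  rewrite v'0 => -[sE cn ev].
  (* The completed number is at most [n], below the cap, and digits never decrease a value; so the
     cap did not act here. *)
  have v'E : v' = v.*2 + b.
    case/andP: (ev) (bits_value_ge v' e) => _.
    by move: (bits_value _ _) => z; rewrite /v' -/B; lia.
  case: eqP lok v'E => [->|/eqP v0] /=.
    rewrite orbF => -> v'1; rewrite (v'1 : v' = 1) in ev.
    have [j jE] : exists j : 'I_n, j.+1 = bits_value 1 e.
      have jn : (bits_value 1 e).-1 < n by lia.
      by exists (Ordinal jn) => /=; rewrite prednK //; lia.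
    exists [::], (j :: js), fs; split; last by rewrite /= -addSnnS.
    by rewrite /= /encode_point jE binary_bits_value sE /= cat_rcons -?catA.
  by move=> _ v'E; exists (b :: e), js, fs; rewrite sE /= -v'E.
- have s0 : s != [::] by apply: contra_eq_neq lst => ->.
  have lst' : last EndTable s = EndTable by case: (s) s0 lst.
  have [//|e [js [fs [sE cn]]]] := IH 0 _ _ sok s0 lst'.
  exists [::], js, fs; rewrite gtn_eqF; last by case/andP: lok.
  by split=> //=; [rewrite -sE|move: cn; rewrite -/B; lia].
case/andP: lok => /eqP-> /eqP-> in sok *.
have [->|s0] := eqVneq s [::].
  by exists [::], [::], [::]; split=> //; rewrite addn0.
have lst' : last EndTable s = EndTable by case: (s) s0 lst.
have [//|e [js [fs [sE cn]]]] := IH 0 _ _ sok s0 lst'.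
have [f fE] := encode_cons fs cn.
by exists [::], [::], (f :: fs); split; [rewrite sE fE|rewrite addn0].
Qed.

End Degree.

Variable n : nat.
Implicit Types fs : seq (transf n).

Lemma size_encode_transf (f : transf n) : n < size (encode_transf f).
Proof.
rewrite size_rcons ltnS size_flatten -[X in X <= _](size_enum_ord n).
rewrite /shape -map_comp; elim: (enum 'I_n) => //= i s IH.
by rewrite size_rcons addSn ltnS (leq_trans IH) ?leq_addl.
Qed.

Lemma size_encode fs : fs != [::] -> n < size (encode fs).
Proof.
case: fs => // f fs _; rewrite [encode _]/= size_cat.
exact: leq_trans (size_encode_transf f) (leq_addr _ _).
Qed.

Lemma size_encode_ge fs : size fs <= size (encode fs).
Proof.
elim: fs => //= f fs IH; rewrite [encode _]/= size_cat -add1n leq_add //.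
by rewrite (leq_ltn_trans _ (size_encode_transf f)).
Qed.

End Encoding.

Section Well_formed.
Variables (n : nat) (fs : seq (transf n)).
Hypotheses (n0 : 0 < n) (fs0 : fs != [::]).
Let w := encode fs.
Notation ev := (eval w).

Let w_rcons : exists u, w = rcons u EndTable.
Proof.
rewrite /w; case/lastP: fs fs0 => // gs f _.
exists (encode gs ++ flatten [seq encode_point (f i) | i <- enum 'I_n]).
by rewrite /encode map_rcons flatten_rcons rcons_cat.
Qed.

Let w_ok : word_ok w n 0 0 w.
Proof. by apply: word_ok_encode; rewrite ltnS ltnW ?size_encode. Qed.

Lemma eval_Degree_encode env : ev env Degree = n.
Proof.
have [u wu] := w_rcons.
rewrite eval_Degree; last by rewrite wu; case: (u).
have -> : take (size w).-1 w = u by rewrite wu size_rcons -cats1 take_size_cat.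
have := w_ok; rewrite [X in word_ok _ _ _ _ X]wu -cats1 word_ok_cat.
by case/andP=> _ /= /andP[/andP[_ /eqP]].
Qed.

Lemma eval_Rank_encode env : ev env Rank = size fs.
Proof.
rewrite eval_Rank; have := image_step_proj w 0 0 0 0 0 0 w.
rewrite -[X in foldl _ _ X]/(encode fs) image_step_encode; last first.
- by rewrite leqW // size_encode_ge.
- by rewrite ltnS ltnW // size_encode.
by case=> _ _ <-.
Qed.

Lemma eval_Image_encode env (a b : term letter) :
  ev env a < size fs -> ev env b < n ->
  ev env (Image a b) = nth 0 (nth [::] (map (@table n) fs) (ev env a)) (ev env b).
Proof.
move=> ak bn; rewrite eval_Image -[X in foldl _ _ X]/(encode fs) image_step_encode.
- by rewrite /= ak bn subn0.
- by rewrite ltnS ltnW // size_encode.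
by rewrite leqW // size_encode_ge.
Qed.

Lemma Well_formed_encode : ev [::] Well_formed != 0.
Proof.
have [u wu] := w_rcons.
rewrite eval_Well_formed eval_Degree_encode w_ok -lt0n n0.
by rewrite {2}wu last_rcons eqxx wu; case: (u).
Qed.

End Well_formed.

Lemma Well_formedP w : eval w [::] Well_formed != 0 ->
  exists n (fs : seq (transf n)), [/\ 0 < n, fs != [::] & w = encode fs].
Proof.
rewrite eval_Well_formed => /and4P[w0 /eqP lst]; rewrite -lt0n.
set n := eval _ _ _ => n0 wok.
have nB : n < (size w).+1.
  rewrite ltnS /n eval_Degree //; apply: leq_trans (foldl_ent_le _ _ _) _.
  by rewrite add0n size_take_min geq_minr.
have [//|e [js [fs [wE js_n]]]] := parse nB _ wok w0 lst.
by have [f fE] := encode_cons fs js_n; exists n, (f :: fs); rewrite wE fE.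
Qed.

(** * Clifford semigroups of transformations *)

Section Clifford.
Local Open Scope group_scope.
Variable T : semigroupType.

(** Mutual inverses in a subgroup with identity [e], without mention of the subgroup. *)
Definition inverse_pair (a b e : T) : Prop :=
  [/\ a * b = e, b * a = e, e * a = a, a * e = a & e * b = b /\ b * e = b].

Lemma inverse_pair_sym a b e : inverse_pair a b e -> inverse_pair b a e.
Proof. by case=> ab ba ea ae [eb be]; split. Qed.

Lemma inverse_pair_idem a b e : inverse_pair a b e -> e * e = e.
Proof. by case=> ab _ ea _ _; rewrite -{2}ab mulgA ea. Qed.

(** In a a' b' b the inner product is [e'], which commutes past [b] and leaves a b e'; the other
    order is similar. *)
Lemma inverse_pairM a b e a' b' e' :
  (forall c, c \in [:: a; b; a'; b'; e] -> commute e' c) ->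
  commute e a' -> commute e b' ->
  inverse_pair a b e -> inverse_pair a' b' e' ->
  inverse_pair (a * a') (b' * b) (e * e').
Proof.
move=> e'C ea'C eb'C [ab ba ea ae [eb be]] [ab' ba' ea' ae' [eb' be']].
have [e'a e'b _ _ e'e] : [/\ e' * a = a * e', e' * b = b * e', e' * a' = a' * e',
    e' * b' = b' * e' & e' * e = e * e'] by split; apply: e'C; rewrite !inE eqxx ?orbT.
split; last split.
- by rewrite -mulgA (mulgA a') ab' e'b mulgA ab.
- by rewrite -mulgA (mulgA b) ba ea'C mulgA ba' e'e.
- by rewrite -mulgA (mulgA e') e'a -mulgA ea' mulgA ea.
- by rewrite -mulgA (mulgA a') -ea'C -mulgA ae' mulgA ae.
- by rewrite -e'e -mulgA (mulgA e) eb'C -mulgA eb mulgA eb'.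
by rewrite -mulgA (mulgA b) be -e'b mulgA be'.
Qed.

Lemma clifford_of_inverses (S : T -> Prop) :
  (forall a b, S a -> S b -> S (a * b)) ->
  (forall a, S a -> exists b e, [/\ S b, S e, inverse_pair a b e &
     forall c, S c -> commute e c]) ->
  clifford S.
Proof.
move=> SM inv; split=> [a Sa|e f Se Sf ee _]; last first.
  (* An idempotent of a group is its identity: [e] equals [e'], which is central. *)
  have [b [e' [_ _ [eb _ _ ee' _] e'C]]] := inv e Se.
  have : e * e' = e * b by rewrite -[in LHS]eb mulgA ee.
  by rewrite ee' eb => ->; apply: e'C.
have [b [e [Sb Se abe _]]] := inv a Sa; have ee := inverse_pair_idem abe.
(* This is the maximal subgroup of [S] with identity [e]. *)
exists (fun y => S y /\ exists2 z, S z & inverse_pair y z e).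
split; [split | by move=> y [] | by split=> //; exists b].
  move=> x y [Sx [x' Sx' [xx' x'x ex xe [ex' x'e]]]]
    [Sy [y' Sy' [yy' y'y ey ye [ey' y'e]]]].
  split; first exact: SM.
  exists (y' * x'); first exact: SM.
  split; last split.
  - by rewrite -mulgA (mulgA y) yy' ex'.
  - by rewrite -mulgA (mulgA x') x'x ey.
  - by rewrite mulgA ex.
  - by rewrite -mulgA ye.
  - by rewrite mulgA ey'.
  by rewrite -mulgA x'e.
exists e; split.
- by split=> //; exists e => //; split.
- by move=> x [_ [x' _ []]].
move=> x [Sx [x' Sx' xx']]; exists x'.
by split; [split=> //; exists x => //; apply: inverse_pair_sym|case: xx'..].
Qed.

Lemma clifford_of_generators (A : seq T) :
  (forall a, a \in A -> exists b e, [/\ generated A b, generated A e,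
     inverse_pair a b e & forall c, c \in A -> commute e c]) ->
  clifford (generated A).
Proof.
move=> gens; apply: clifford_of_inverses; first exact: Generated_mul.
move=> a Sa; elim: Sa => {a} [a /gens[b [e [Sb Se abe eC]]] |
    a a' Sa [b [e [Sb Se abe eC]]] Sa' [b' [e' [Sb' Se' abe' e'C]]]].
  exists b, e; split=> // c; elim=> {c} [c /eC //|c d _ IHc _ IHd].
  by rewrite /commute mulgA IHc -mulgA IHd mulgA.
exists (b' * b), (e * e'); split; [exact: Generated_mul..| |].
  apply: inverse_pairM => //; [|exact: eC..].
  by move=> c; rewrite !inE => /or4P[/eqP->|/eqP->|/eqP->|/orP[]/eqP->]; apply: e'C.
by move=> c Sc; rewrite /commute -mulgA (e'C c Sc) mulgA (eC c Sc) -mulgA.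
Qed.

Section Central.
Variables (S : T -> Prop).
Hypotheses (SM : forall a b, S a -> S b -> S (a * b)) (cliffS : clifford S).

Lemma clifford_inverse a : S a -> exists b e, [/\ S b, S e & inverse_pair a b e].
Proof.
case: cliffS => reg _ /reg[G [[_ [e [Ge ide inv]]] GS Ga]].
have [b [Gb ab ba]] := inv _ Ga; have [ea ae] := ide _ Ga; have [eb be] := ide _ Gb.
by exists b, e; split; [exact: GS..|split].
Qed.

(* The idempotent g of the group of e s satisfies g = g e = e g. *)
Lemma clifford_central e s : S e -> e * e = e -> S s -> commute e s.
Proof.
move=> Se ee Ss.
have idC g : S g -> g * g = g -> e * g = g * e.
  by move=> Sg gg; case: cliffS => _; apply.
have [u [g [Su Sg esu]]] := clifford_inverse (SM Se Ss).
have [u' [g' [Su' Sg' seu]]] := clifford_inverse (SM Ss Se).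
have eg := idC g Sg (inverse_pair_idem esu).
have eg' := idC g' Sg' (inverse_pair_idem seu).
case: esu => esu _ _ esg _; case: seu => _ seu g'se _ _.
have ege : g * e = g by rewrite -eg -esu !mulgA ee.
have eg'e : e * g' = g' by rewrite eg' -seu -!mulgA ee.
(* Since [e s] absorbs [g] on the right, it absorbs [e] as well; dually for [s e], so both products
   equal e s e. *)
have : e * s * e = e * s by rewrite -[X in X * e]esg -mulgA ege esg.
have : e * (s * e) = s * e by rewrite -[X in e * X]g'se mulgA eg'e g'se.
by rewrite mulgA /commute => <-.
Qed.

End Central.

End Clifford.

(** * The criterion on images and kernels *)

Section Transformations.
Variable n : nat.
Implicit Types (a b c : transf n) (A : seq (transf n)).

(* [a] is injective on its image, and [c] preserves the kernel and the image
   of [a]; these determine the idempotent power of [a]. *)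
Definition compatible a c : Prop := forall x y,
  [/\ a (a x) = a (a y) -> a x = a y, a x = a y -> a (c x) = a (c y)
    & exists u, a u = c (a x)].

Definition power a k : transf n := iter k (@mul (transf n) a) a.

Lemma powerE a k x : power a k x = iter k.+1 a x.
Proof. by rewrite /power; elim: k x => //= k IH x; rewrite transf_mulE IH -iterSr. Qed.

Lemma generated_power A a k : a \in A -> generated A (power a k).
Proof.
move=> aA; rewrite /power; elim: k => [|k IH] /=; first exact: Generated_gen.
exact: Generated_mul (Generated_gen aA) IH.
Qed.

(** Two of the powers of [a] coincide by the pigeonhole principle, and injectivity on the image
    cancels all common factors but one. *)
Lemma power_period a :
  (forall x y, a (a x) = a (a y) -> a x = a y) ->
  exists r, forall x, iter r.+2 a x = a x.
Proof.
move=> a_inj.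
have cancel k x y : iter k.+1 a x = iter k.+1 a y -> a x = a y.
  by elim: k => //= k IH /a_inj.
have /injectivePn[i [j ij eij]] :
    ~~ injectiveb (fun i : 'I_#|{: transf n}|.+1 => power a i).
  by apply/negP => /injectiveP /leq_card; rewrite card_ord ltnn.
wlog lt_ij : i j ij eij / i < j.
  move=> wl; case: (ltngtP i j) => [ltij|ltji|/val_inj eq_ij].
  - exact: wl ij eij ltij.
  - by apply: wl ltji; rewrite 1?eq_sym.
  by rewrite eq_ij eqxx in ij.
exists (j - i.+1) => x; apply/esym.
rewrite -[iter _ _ _]/(a (iter (j - i.+1).+1 a x)); apply: (cancel i).
rewrite -powerE eij powerE -iterD; congr (iter _ a x); lia.
Qed.

Lemma compatible_inverse A a : a \in A ->
  (forall c, c \in A -> compatible a c) ->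
  exists b e, [/\ generated A b, generated A e, inverse_pair a b e &
    forall c, c \in A -> commute e c].
Proof.
move=> aA comp.
have [|r a_r] := @power_period a; first by move=> x y; case: (comp a aA x y).
have per m x : iter (r.+1 + m.+1) a x = iter m.+1 a x.
  by rewrite addnS -addSn iterD a_r.
(* [power a k] has exponent [k + 1], so the identity is the power [r + 1]. Its natural partner would
   be the power [r], but [r] may be 0; adding the period [r + 1] gives exponent [2r + 1]. *)
exists (power a r.*2), (power a r); split; try exact: generated_power.
  split; last split; apply/ffunP=> x; rewrite !transf_mulE !powerE //.
  - by rewrite -iterSr -[RHS]per; congr (iter _ a x); lia.
  - by rewrite -iterS -[RHS]per; congr (iter _ a x); lia.
  - by rewrite -iterS.
  - by rewrite -iterSr.
  - by rewrite -iterD -[RHS]per; congr (iter _ a x); lia.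
  by rewrite -iterD -[RHS]per; congr (iter _ a x); lia.
move=> c cA; apply/ffunP=> x; rewrite !transf_mulE !powerE.
(* The idempotent e fixes the image of [a], so e fixes c(e x); and x, e x have the same image under
   [a], so c x and c(e x) are sent by e to the same point. *)
have [_ _ [u uE]] := comp c cA (iter r a x) x.
have fixE : iter r.+1 a (c (iter r.+1 a x)) = c (iter r.+1 a x).
  by rewrite [X in c X]iterS -uE -iterSr a_r.
have [_ + _] := comp c cA (iter r.+1 a x) x => /(_ (a_r x)) ker.
by rewrite -fixE iterSr ker -iterSr.
Qed.

(** The point e z = b(a z) depends on a z only, and a = e a = a e. As e commutes with [c], it can be
    inserted before or after [c], which yields kernel and image. *)
Lemma clifford_compatible A a c :
  clifford (generated A) -> a \in A -> c \in A -> compatible a c.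
Proof.
move=> cliff aA cA x y.
have Sa := Generated_gen aA; have Sc := Generated_gen cA.
have SM := @Generated_mul _ A.
have [b [e [Sb Se abe]]] := clifford_inverse cliff Sa.
have ec := clifford_central SM cliff Se (inverse_pair_idem abe) Sc.
case: abe => ab ba ea ae _.
have eE z : e z = b (a z) by rewrite -ab transf_mulE.
split=> [eq_aa|eq_a|].
- have aab z : a z = b (a (a z)) by rewrite -eE -transf_mulE ae.
  by rewrite aab eq_aa -aab.
- have aca z : a (c z) = a (c (e z)).
    by rewrite -[in LHS]ea transf_mulE -[e (c z)]transf_mulE -ec transf_mulE.
  by rewrite aca eE eq_a -eE -aca.
exists (b (c (a x))).
by rewrite -!transf_mulE ba -ec mulgA ae.
Qed.

Lemma cliffordP A : clifford (generated A) <->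
  forall a c, a \in A -> c \in A -> compatible a c.
Proof.
split=> [cliff a c aA cA|comp]; first exact: clifford_compatible cliff aA cA.
by apply: clifford_of_generators => a aA; apply: compatible_inverse => // c cA; apply: comp.
Qed.

End Transformations.

(** * The algorithm *)

(* Under the four quantifiers of [Clifford], variables 7, 5, 3 and 1 stand for
   two generators and two points. *)
Definition Compatible : term letter :=
  let a := Image (Var 7) in let c := Image (Var 5) in
  let x := Var 3 in let y := Var 1 in
  And (Imp (Eq (a (a x)) (a (a y))) (Eq (a x) (a y)))
  (And (Imp (Eq (a x) (a y)) (Eq (a (c x)) (a (c y))))
  (Ex Degree (Eq (Image (Var 9) (Var 1)) (Image (Var 7) (Image (Var 9) (Var 5)))))).

Definition Clifford : term letter := And Well_formed
  (All Rank (All Rank (All Degree (All Degree Compatible)))).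

Section Correctness.
Variables (n : nat) (fs : seq (transf n)).
Hypotheses (n0 : 0 < n) (fs0 : fs != [::]).
Let w := encode fs.
Notation ev := (eval w).

Lemma ImageE env (s t : term letter) (x : 'I_n) (f : transf n) :
  ev env s < size fs -> nth f fs (ev env s) = f -> ev env t = x ->
  ev env (Image s t) = f x.
Proof.
move=> sk fE tx; rewrite eval_Image_encode ?tx //.
by rewrite (nth_map f) // fE table_nth.
Qed.

Definition compatibleb (a c : transf n) (x y : 'I_n) :=
  [&& (a (a x) == a (a y)) ==> (a x == a y),
      (a x == a y) ==> (a (c x) == a (c y)) & [exists u, a u == c (a x)]].

Lemma eval_Compatible i j (x y : 'I_n) p q r s (f : transf n) :
  i < size fs -> j < size fs ->
  (ev [:: p; y : nat; q; x : nat; r; j; s; i] Compatible != 0) =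
  compatibleb (nth f fs i) (nth f fs j) x y.
Proof.
move=> ik jk; set a := nth f fs i; set c := nth f fs j.
have aE env t (z : 'I_n) k : nth 0 env k = i -> ev env t = z ->
    ev env (Image (Var k) t) = a z.
  by move=> ki tz; apply: ImageE => //=; rewrite ki //; apply: set_nth_default.
have cE env t (z : 'I_n) k : nth 0 env k = j -> ev env t = z ->
    ev env (Image (Var k) t) = c z.
  by move=> kj tz; apply: ImageE => //=; rewrite kj //; apply: set_nth_default.
set env := [:: p, _ & _].
have ax : ev env (Image (Var 7) (Var 3)) = a x by apply: aE.
have ay : ev env (Image (Var 7) (Var 1)) = a y by apply: aE.
have aax : ev env (Image (Var 7) (Image (Var 7) (Var 3))) = a (a x) by apply: aE.
have aay : ev env (Image (Var 7) (Image (Var 7) (Var 1))) = a (a y) by apply: aE.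
have acx : ev env (Image (Var 7) (Image (Var 5) (Var 3))) = a (c x).
  by apply: aE => //; apply: cE.
have acy : ev env (Image (Var 7) (Image (Var 5) (Var 1))) = a (c y).
  by apply: aE => //; apply: cE.
etransitivity; first exact: eval_And.
congr (_ && _).
  by etransitivity; [exact: eval_Imp | rewrite !eval_Eq ax ay aax aay].
etransitivity; first exact: eval_And.
congr (_ && _).
  by etransitivity; [exact: eval_Imp | rewrite !eval_Eq ax ay acx acy].
apply: eval_Ex_ord => [|z u]; first exact: eval_Degree_encode.
have au : eval w [:: z, u : nat & env] (Image (Var 9) (Var 1)) = a u by apply: aE.
have cax : eval w [:: z, u : nat & env] (Image (Var 7) (Image (Var 9) (Var 5))) = c (a x).
  by apply: cE => //; apply: aE.
by rewrite eval_Eq au cax.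
Qed.

Lemma compatibleP a c : reflect (compatible a c) [forall x, forall y, compatibleb a c x y].
Proof.
apply: (iffP forallP) => [ac x y|ac x].
  case/forallP/(_ y)/and3P: (ac x) => /implyP inj /implyP ker /existsP[u /eqP uE].
  by split=> [/eqP/inj/eqP|/eqP/ker/eqP|]; last exists u.
apply/forallP => y; case: (ac x y) => inj ker [u uE]; apply/and3P; split.
- by apply/implyP => /eqP/inj->.
- by apply/implyP => /eqP/ker->.
by apply/existsP; exists u; apply/eqP.
Qed.

Lemma eval_Clifford : ev [::] Clifford != 0 <-> clifford (generated fs).
Proof.
(* A default value for [nth]; all indices that occur are in range. *)
pose f : transf n := [ffun x => x].
have deg env : ev env Degree = n by apply: eval_Degree_encode.
have rk env : ev env Rank = size fs by apply: eval_Rank_encode.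
rewrite /Clifford (eval_And _ _ Well_formed) Well_formed_encode // andTb.
rewrite (@eval_All_ord _ w _ _ _ _ (fun i : 'I_(size fs) => [forall j : 'I_(size fs),
  [forall x, forall y, compatibleb (nth f fs i) (nth f fs j) x y]]) (rk _)); last first.
  move=> s i; apply: eval_All_ord => // r j; apply: eval_All_ord => // q x.
  by apply: eval_All_ord => // p y; apply: eval_Compatible.
rewrite cliffordP; split=> [/forallP all a c|all].
  move=> /(nthP f)[i ik <-] /(nthP f)[j jk <-].
  by have /forallP/(_ (Ordinal jk))/compatibleP := all (Ordinal ik).
apply/forallP => i; apply/forallP => j; apply/compatibleP.
by apply: all; apply: mem_nth.
Qed.

End Correctness.

Theorem corollary5p8 : NL clifford_problem.
Proof.
have [M [c MP]] := term_NL Clifford.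
exists M, c => w; have [hl sp ac] := MP w; split=> //; rewrite ac {MP hl sp ac}.
split=> [|[n [k [a [n0 k0 -> cliff]]]]].
  rewrite eval_And => /andP[/Well_formedP[n [fs [n0 fs0 ->]]] cliff].
  exists n, (size fs), (in_tuple fs); split=> //; first by rewrite lt0n size_eq0.
  by apply/(eval_Clifford n0 fs0); rewrite eval_And Well_formed_encode.
by apply/eval_Clifford; rewrite // -size_eq0 size_tuple -lt0n.
Qed.
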